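(* For every integer $n\ge 2$ let $L(n+1,n+1)$ be the L-shaped square-tiled translation surface of genus $2$ described in the context. Then $$\lim_{n\to+\infty}\mathrm{KVol}(L(n+1,n+1))=2.$$
   Context: The surface $L(n+1,n+1)$. For an integer $n\ge 2$, let $P_n=\big([0,1]\times[0,n+1]\big)\cup\big([0,n+1]\times[0,1]\big)\subset\mathbb{R}^2$, an L-shaped polygon tiled by $2n+1$ unit squares. $L(n+1,n+1)$ is the translation surface obtained from $P_n$ by identifying, by translations, the following pairs of boundary segments: $[0,1]\times\{0\}$ with $[0,1]\times\{n+1\}$; $[1,n+1]\times\{0\}$ with $[1,n+1]\times\{1\}$; $\{0\}\times[0,1]$ with $\{n+1\}\times[0,1]$; $\{0\}\times[1,n+1]$ with $\{1\}\times[1,n+1]$. It is a closed oriented surface of genus $2$ (orientation from $\mathbb{R}^2$) with a flat metric having exactly one conical point $S$, of angle $6\pi$ (the common image of the points $(0,0),(1,0),(n+1,0),(0,1),(1,1),(n+1,1),(0,n+1),(1,n+1)$); that is, it belongs to the stratum $\mathcal{H}(2)$. Definition of $\mathrm{KVol}$. Let $X$ be a closed oriented surface with a metric $g$ (here $X=L(n+1,n+1)$ and $g$ is the flat metric induced by the Euclidean metric of $P_n\subset\mathbb{R}^2$, with the single conical singularity $S$ of angle $6\pi$). $\mathrm{Int}(\cdot,\cdot)$ denotes the algebraic intersection form on $H_1(X,\mathbb{R})$, and for closed curves $\alpha,\beta$ in $X$, $\mathrm{Int}(\alpha,\beta)$ is the algebraic intersection number of their homology classes. $\mathrm{Vol}(X,g)$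 is the total area and $l_g(\alpha)$ is the length of $\alpha$. Then $$\mathrm{KVol}(X,g)=\mathrm{Vol}(X,g)\,\sup_{\alpha,\beta}\frac{\mathrm{Int}(\alpha,\beta)}{l_g(\alpha)\,l_g(\beta)},$$ where the supremum ranges over all piecewise smooth closed curves $\alpha$ and $\beta$ in $X$ (of positive length). *)

(* Defs.v *)
From HB Require Import structures.
From mathcomp.multinomials Require Import freeg.
From mathcomp Require Import all_boot all_order all_algebra.
From mathcomp Require Import generic_quotient.
From mathcomp Require Import all_classical all_reals all_analysis.
From Stdlib Require Import Relation_Operators.

Set Implicit Arguments.
Unset Strict Implicit.
Unset Printing Implicit Defensive.

Import Order.TTheory GRing.Theory Num.Theory.
Import numFieldNormedType.Exports.

Local Open Scope classical_set_scope.
Local Open Scope ring_scope.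
Local Open Scope quotient_scope.

(** * Singular homology with real coefficients, and the intersection form *)

Section StandardSimplex.
Variable R : realType.

Definition std_simplex (k : nat) : set 'rV[R]_k.+1 :=
  [set v | (forall i, 0 <= v 0 i) /\ \sum_i v 0 i = 1].
Arguments std_simplex k : clear implicits.

Definition face_row k (i : 'I_k.+2) (v : 'rV[R]_k.+1) : 'rV[R]_k.+2 :=
  \row_j (if unlift i j is Some j' then v 0 j' else 0).

Lemma face_row_simplex k (i : 'I_k.+2) v :
  std_simplex k v -> std_simplex k.+1 (face_row i v).
Proof.
move=> [v0 v1]; split => [j|].
  by rewrite mxE; case: unliftP => [j' _|_].
rewrite (bigD1_ord i) //= mxE unlift_none add0r -[RHS]v1.
by apply: eq_bigr => j _; rewrite mxE liftK.
Qed.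

(* The inclusion of the [k]-simplex as the face opposite to the vertex [i]. *)
Definition face_map k (i : 'I_k.+2) (v : std_simplex k) : std_simplex k.+1 :=
  exist _ (face_row i (val v)) (mem_set (face_row_simplex i (set_valP v))).

Lemma entry_continuous k (j : 'I_k.+1) :
  continuous (fun v : std_simplex k => (val v : 'rV[R]_k.+1) 0 j).
Proof.
move=> v; apply: (@continuous_comp _ _ _ (fun v : std_simplex k => val v)
  (fun v : 'rV[R]_k.+1 => v 0 j)); first exact: initial_continuous.
exact: coord_continuous.
Qed.

Lemma face_map_continuous k (i : 'I_k.+2) : continuous (face_map i).
Proof.
apply: continuous_comp_initial => v /= A [P vP PA].
pose f w : 'rV[R]_k.+2 := face_row i (val (w : std_simplex k)).
suff H a j : \forall w \near v, P a j (f w a j).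
  have : \forall w \near v, forall aj : 'I_1 * 'I_k.+2,
      P aj.1 aj.2 (f w aj.1 aj.2).
    apply: (@filter_forall _ _
      (fun aj w => P aj.1 aj.2 (f w aj.1 aj.2)) (nbhs v)) => -[a j]; exact: H.
  by apply: filterS => w Pw; apply: PA => a j; exact: (Pw (a, j)).
have := vP a j; rewrite /f [in X in X -> _]/set_val /= mxE.
case E : (unlift i j) => [j'|] Pv.
- have h : nbhs v [set w | P a j ((val w : 'rV_k.+1) 0 j')].
    exact: (@entry_continuous k j' v _ Pv).
  by apply: (@filterS _ (nbhs v) _ _ _ _ h) => w /=; rewrite mxE E.
- apply: (@filterS _ (nbhs v) _ setT) => [w _|]; last exact: filterT.
  by rewrite mxE E; exact: nbhs_singleton.
Qed.

HB.instance Definition _ k (i : 'I_k.+2) :=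
  isContinuous.Build _ _ (face_map i) (@face_map_continuous k i).

End StandardSimplex.
Arguments std_simplex R k : clear implicits.

Section SingularHomology.
Variables (R : realType) (X : topologicalType).

Definition singular_simplex (k : nat) := continuousType (std_simplex R k) X.

Definition chain (k : nat) := {freeg (singular_simplex k) / R}.

Definition face k (i : 'I_k.+2) (s : singular_simplex k.+1) :
    singular_simplex k :=
  (s \o face_map i : continuousType _ _).

Definition boundary k : chain k.+1 -> chain k :=
  fglift (fun s => \sum_(i < k.+2) (-1) ^+ i *: (<< face i s >> : chain k)).

Definition homologous (z w : chain 1) : Prop :=
  exists c : chain 2, z - w = boundary c.

Definition cochain (k : nat) := singular_simplex k -> R.

Definition pairing k (phi : cochain k) : chain k -> R :=
  fglift (phi : _ -> R^o).

Definition cocycle (phi : cochain 1) : Prop :=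
  forall c : chain 2, pairing phi (boundary c) = 0.

(* Cup and cap products in degree one, where the front face [v0, v1] of
   [v0, v1, v2] is the face opposite to v2, and the back face [v1, v2] is the
   face opposite to v0. *)
Definition cup (phi psi : cochain 1) : cochain 2 :=
  fun s => phi (face ord_max s) * psi (face ord0 s).

Definition cap (m : chain 2) (phi : cochain 1) : chain 1 :=
  fglift (fun s => phi (face ord_max s) *: (<< face ord0 s >> : chain 1)) m.

(* For a cycle [m] representing the fundamental class of a closed oriented
   surface, phi |-> m \cap phi is the Poincare duality isomorphism from H^1 to
   H_1, and the intersection form on H_1 is, through it, the cup product form
   on H^1.  Hence the set below is a singleton if z and w are cycles. *)
Definition intersection (m : chain 2) (z w : chain 1) : R :=
  xget 0 [set x | exists phi psi : cochain 1,
    [/\ cocycle phi /\ cocycle psi,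
        homologous (cap m phi) z, homologous (cap m psi) w
      & x = pairing (cup phi psi) m]].

Lemma path_simplex_subproof (v : std_simplex R 1) :
  `[0, 1]%classic ((val v : 'rV[R]_2) 0 1).
Proof.
have [v0 /=] := set_valP v; rewrite big_ord_recl big_ord1 => v1.
have e : lift ord0 ord0 = 1 :> 'I_2 by exact/val_inj.
rewrite e in v1; rewrite /= in_itv /= v0 -v1 lerDr; exact: v0.
Qed.

Definition path_simplex_fun (g : R -> X) (v : std_simplex R 1) : X :=
  g ((val v : 'rV[R]_2) 0 1).

Lemma path_simplex_continuous (g : R -> X) :
  {within `[0, 1], continuous g} -> continuous (path_simplex_fun g).
Proof.
move=> /subspace_sigL_continuousP cg.
pose e (v : std_simplex R 1) : `[(0 : R), 1]%classic :=
  exist (fun t => t \in `[(0 : R), 1]%classic) _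
    (mem_set (path_simplex_subproof v)).
have ce : continuous e.
  by apply: continuous_comp_initial; exact: (@entry_continuous R 1 1).
move=> v; exact: (@continuous_comp _ _ _ e _ v (ce v) (cg (e v))).
Qed.

(* A path [0, 1] -> X as a singular 1-simplex, the point t of [0, 1] being the
   point (1 - t, t) of the standard 1-simplex. *)
Definition path_simplex (g : R -> X)
    (cg : {within `[0, 1], continuous g}) : singular_simplex 1 :=
  mkcts (path_simplex_continuous cg).

End SingularHomology.

(** * The translation surface L(n+1,n+1) *)

Section LSurface.
Variables (R : realType) (n : nat).

Definition box (a b c d : R) : set (R * R) := `[a, b] `*` `[c, d].

Definition Lpoly : set (R * R) :=
  box 0 1 0 n.+1%:R `|` box 0 n.+1%:R 0 1.

Definition glued (p q : R * R) : Prop :=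
  exists t : R,
  [\/ 0 <= t <= 1 /\ (p = (t, 0) /\ q = (t, n.+1%:R)),
      1 <= t <= n.+1%:R /\ (p = (t, 0) /\ q = (t, 1)),
      0 <= t <= 1 /\ (p = (0, t) /\ q = (n.+1%:R, t))
    | 1 <= t <= n.+1%:R /\ (p = (0, t) /\ q = (1, t))].

Definition Lrel (p q : Lpoly) : bool :=
  `[< clos_refl_sym_trans Lpoly (fun p q => glued (val p) (val q)) p q >].

Lemma Lrel_refl : reflexive Lrel.
Proof. by move=> p; apply/asboolP; exact: rst_refl. Qed.

Lemma Lrel_sym : symmetric Lrel.
Proof. by move=> p q; apply/idP/idP => /asboolP h; apply/asboolP/rst_sym. Qed.

Lemma Lrel_trans : transitive Lrel.
Proof.
move=> q p r /asboolP pq /asboolP qr; apply/asboolP; exact: rst_trans pq qr.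
Qed.

Canonical Lequiv := EquivRel Lrel Lrel_refl Lrel_sym Lrel_trans.

Definition Lsurface : topologicalType :=
  quotient_topology {eq_quot Lequiv}.

Definition Lproj (p : Lpoly) : Lsurface :=
  \pi_(quotient_topology {eq_quot Lequiv}) p.

Lemma Lproj_continuous : continuous Lproj.
Proof. exact: pi_continuous. Qed.

(** ** The fundamental class *)

Definition affine (p : 3.-tuple (R * R)) (v : 'rV[R]_3) : R * R :=
  (\sum_i v 0 i * (tnth p i).1, \sum_i v 0 i * (tnth p i).2).

Lemma affine_box a b c d p v : (forall i, box a b c d (tnth p i)) ->
  std_simplex R 2 v -> box a b c d (affine p v).
Proof.
move=> hp [v0 v1].
have cvx (x y : R) (z : 'I_3 -> R) : (forall i, x <= z i <= y) ->
    x <= \sum_i v 0 i * z i <= y.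
  move=> hz; rewrite -[x]mul1r -[y]mul1r -v1 !mulr_suml.
  by apply/andP; split; apply: ler_sum => i _; apply: (ler_wpM2l (v0 i));
    case/andP: (hz i).
by split; rewrite /= in_itv /=; apply: cvx => i; have [] := hp i;
  rewrite /= !in_itv.
Qed.

Section Triangle.
Variables (a b c d : R) (sub : box a b c d `<=` Lpoly).
Variables (p : 3.-tuple (R * R)) (hp : forall i, box a b c d (tnth p i)).

Definition triangle_point (v : std_simplex R 2) : Lpoly :=
  exist _ (affine p (val v)) (mem_set (sub (affine_box hp (set_valP v)))).

Lemma triangle_continuous : continuous (Lproj \o triangle_point).
Proof.
have cc (z : 'I_3 -> R) :
    continuous (fun w : std_simplex R 2 => \sum_i (val w : 'rV[R]_3) 0 i * z i).
  apply: continuous_big => [|i _ w]; first exact: add_continuous.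
  exact: (cvgM (@entry_continuous R 2 i w) (cvg_cst (z i))).
have ce : continuous triangle_point.
  apply: continuous_comp_initial => v.
  exact: (cvg_pair (cc (fun i => (tnth p i).1) v)
    (cc (fun i => (tnth p i).2) v)).
move=> v; exact: (@continuous_comp _ _ _ _ _ v (ce v) (@Lproj_continuous _)).
Qed.

Definition triangle : singular_simplex R Lsurface 2 := mkcts triangle_continuous.

End Triangle.

Section Rectangle.
Variables (a b c d : R) (ab : a <= b) (cd : c <= d).
Variable sub : box a b c d `<=` Lpoly.

Definition lower_tri : 3.-tuple (R * R) := [tuple (a, c); (b, c); (b, d)].
Definition upper_tri : 3.-tuple (R * R) := [tuple (a, c); (a, d); (b, d)].

Lemma lower_tri_box i : box a b c d (tnth lower_tri i).
Proof.
by case: i => -[|[|[|//]]] i; rewrite (tnth_nth 0); split;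
  rewrite /= in_itv /= ?lexx ?ab ?cd.
Qed.

Lemma upper_tri_box i : box a b c d (tnth upper_tri i).
Proof.
by case: i => -[|[|[|//]]] i; rewrite (tnth_nth 0); split;
  rewrite /= in_itv /= ?lexx ?ab ?cd.
Qed.

(* The counterclockwise triangle minus the clockwise one. *)
Definition rect_chain : chain R Lsurface 2 :=
  << triangle sub lower_tri_box >> - << triangle sub upper_tri_box >>.

End Rectangle.

Lemma le1n : 1 <= n.+1%:R :> R.
Proof. by rewrite ler1n. Qed.

Lemma sub_corner : box 0 1 0 1 `<=` Lpoly.
Proof.
move=> [x y] [/= hx]; rewrite in_itv /= => /andP[y0 y1]; left; split => //=.
by rewrite in_itv /= y0 (le_trans y1 le1n).
Qed.

Lemma sub_up : box 0 1 1 n.+1%:R `<=` Lpoly.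
Proof.
move=> [x y] [/= hx]; rewrite in_itv /= => /andP[y0 y1]; left; split => //=.
by rewrite in_itv /= y1 (le_trans ler01 y0).
Qed.

Lemma sub_right : box 1 n.+1%:R 0 1 `<=` Lpoly.
Proof.
move=> [x y] [/=]; rewrite in_itv /= => /andP[x0 x1] hy; right; split => //=.
by rewrite in_itv /= x1 (le_trans ler01 x0).
Qed.

(* The fundamental class of L(n+1,n+1), for the orientation of the plane: the
   polygon is cut into the corner square and the two arms, and each of these
   rectangles along a diagonal. *)
Definition fundamental_cycle : chain R Lsurface 2 :=
  rect_chain ler01 ler01 sub_corner + rect_chain ler01 le1n sub_up
  + rect_chain le1n ler01 sub_right.

(** ** Closed curves, and KVol *)

Definition smooth (f : R -> R) : Prop := forall k t, derivable (f^`(k))%classic t 1.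

(* Smooth up to the end points on each interval of some subdivision of [0,1]. *)
Definition piecewise_smooth (f : R -> R) : Prop :=
  exists2 s : seq R, itv_partition 0 1 s &
    forall i, (i < size s)%N -> exists2 g : R -> R, smooth g &
      {in `[nth 0 (0 :: s) i, nth 0 (0 :: s) i.+1], f =1 g}.

(* The gluings are translations by integer vectors and all the vertices are
   integral, so the inclusion of the polygon in the plane induces a map from the
   surface to the torus R^2/Z^2.  It is a covering branched only at the conical
   point, and its local inverses near the other points are the charts of the
   translation structure.  Accordingly, a curve in the surface is read in the
   flat charts through a lift [(dev_x, dev_y)] to R^2 of its image in the
   torus; this lift is unique up to a translation by a vector of Z^2, so its
   smoothness and its length are those of the curve. *)
Record closed_curve := ClosedCurve {
  curve : R -> Lsurface;
  dev_x : R -> R;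
  dev_y : R -> R;
  curve_continuous : {within `[0, 1], continuous curve};
  curve_closed : curve 0 = curve 1;
  curve_dev : forall t, 0 <= t <= 1 -> exists (p : Lpoly) (a b : int),
    [/\ curve t = Lproj p, dev_x t = (val p).1 + a%:~R
      & dev_y t = (val p).2 + b%:~R];
  dev_x_smooth : piecewise_smooth dev_x;
  dev_y_smooth : piecewise_smooth dev_y }.

Definition length (al : closed_curve) : R :=
  \int[lebesgue_measure]_(t in `[0, 1])
    Num.sqrt ((dev_x al)^`()%classic t ^+ 2 + (dev_y al)^`()%classic t ^+ 2).

Definition curve_chain (al : closed_curve) : chain R Lsurface 1 :=
  << path_simplex (@curve_continuous al) >>.

Definition Int (al be : closed_curve) : R :=
  intersection fundamental_cycle (curve_chain al) (curve_chain be).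

Definition Vol : \bar R := (lebesgue_measure \x lebesgue_measure)%E Lpoly.

Definition KVol : \bar R :=
  (Vol * ereal_sup [set x | exists al be : closed_curve,
     [/\ (0 < length al)%R, (0 < length be)%R
       & x = (Int al be / (length al * length be))%R%:E]])%E.

End LSurface.
Arguments Lpoly R n : clear implicits.

(* Main.v *)
(* In fact KVol(L(n+1,n+1)) = 2 + 1/n for n > 0.  Orient the edges of the polygon
   to the right and upwards.  A 1-cocycle is determined on the triangulation of
   the polygon by its values (p, q, r, s) on the edges [0,1] x 0, 0 x [1,n+1],
   [1,n+1] x 0 and 0 x [0,1], and the cup product form is
   (ps' - sp') + (pq' - qp') + (rs' - sr').  The cocycles dual to these edges are
   the windings of four circle-valued functions that are affine on the corner
   square and on both arms, so the intersection number of two curves is a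
   bilinear expression in the windings of these functions along the curves.
   A linear combination of the functions whose gradient has norm at most C on
   the three pieces winds at most C l(be) along be.  Fixing al, the intersection
   number with be is such a winding, with a C which, by the same bound applied
   to al, is at most l(al)/n.  Hence Int(al, be) <= l(al) l(be) / n, with
   equality for the closed edges [0,1] x 0 and 0 x [1,n+1]; the area is 2n+1. *)

From HB Require Import structures.
From mathcomp.multinomials Require Import freeg.
From mathcomp Require Import all_boot all_order all_algebra ring lra.
From mathcomp Require Import all_classical all_reals all_analysis.
From mathcomp Require Import measurable_realfun.
From Stdlib Require Import Relation_Operators.
Require Import Defs.

Set Implicit Arguments.
Unset Strict Implicit.
Unset Printing Implicit Defensive.

Import Order.TTheory GRing.Theory Num.Theory.
Import numFieldNormedType.Exports.

Local Open Scope classical_set_scope.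
Local Open Scope ring_scope.

(** * Continuous induction, and lifting of functions with values modulo 1 *)

(** A gradient bound cannot simply be integrated in charts: a curve may meet the conical point,
    which has no chart, at infinitely many times. Instead, nearby times are compared with one fixed
    time only, through representatives in the polygon that share a piece, and continuous induction
    adds up these estimates. The factor 1/n arises as follows. Let (x, y) be n times the gradient,
    on one piece, of the combination dual to a curve. Some combination of norm at most |(x, y)| on
    all pieces winds exactly x^2 + y^2 along that same curve, whence |(x, y)| is at most its length.
    It exists because two of the functions have gradient 1/n on an arm and vanish elsewhere, so that
    they can be used with large weights. The intersection number is a choice from a set that might
    be empty. The upper bound is therefore proved for every element of the set and for the default
    value 0, and dual cocycles are exhibited only for the two extremal edges; the existence of
    Poincare duals for arbitrary curves is never invoked. *)

Lemma real_induction (R : realType) (P : R -> Prop) (a b : R) :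
  a <= b -> P a ->
  (forall t, a <= t < b -> P t -> \forall s \near t^'+, P s) ->
  (forall t, a < t <= b -> (forall s, a <= s < t -> P s) -> P t) ->
  P b.
Proof.
move=> ab Pa Pr Pl.
pose S := [set t | a <= t <= b /\ forall s, a <= s <= t -> P s].
have Sa : S a.
  split; first by rewrite lexx.
  by move=> s /andP[h1 h2]; rewrite (le_anti (introT andP (conj h1 h2))) in Pa *.
have Sb : ubound S b by move=> t [/andP[]].
have supS : has_sup S by split; [exists a | exists b].
set c := sup S.
have ac : a <= c by have [_ S2] := supS; exact: (ub_le_sup S2 Sa).
have cb : c <= b by apply: ge_sup => //; exists a.
have Plt s : a <= s < c -> P s.
  case/andP=> h1 h2; have [t [_ St] lt] := sup_adherent (eps := c - s)
    ltac:(by rewrite subr_gt0) supS.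
  by apply: St; rewrite h1 ltW // (le_lt_trans _ lt) // -/c; lra.
have Pc : P c.
  move: ac; rewrite le_eqVlt => /predU1P[<- //|ac].
  by apply: Pl => //; rewrite ac.
have Sc : S c.
  split; first by rewrite ac cb.
  move=> s /andP[h1]; rewrite le_eqVlt => /predU1P[-> //|h2].
  by apply: Plt; rewrite h1.
move: cb; rewrite le_eqVlt => /predU1P[<- //|cb].
have /Pr : a <= c < b by rewrite ac.
case/(_ Pc) => e /= e0 he.
pose d := c + Num.min (e / 2) (b - c).
have dc : c < d by rewrite /d ltrDl lt_min; apply/andP; split; lra.
have db : d <= b by rewrite /d -lerBrDl ge_min lexx orbT.
have dce : d - c < e.
  rewrite /d addrC addKr; apply: (@le_lt_trans _ _ (e / 2)); last by lra.
  by rewrite ge_min lexx.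
have /(sup_upper_bound supS) : S d.
  split; first by rewrite db andbT (le_trans ac (ltW dc)).
  move=> s /andP[h1 h2]; have [sc|sc] := leP s c.
    by apply: Sc.2; rewrite h1.
  apply: he => //=; rewrite distrC ger0_norm; last by lra.
  by apply: le_lt_trans dce; lra.
by rewrite -/c leNgt dc.
Qed.

Section Mod1.
Variable R : realType.

Lemma int_norm_lt1 (x : R) : x \is a Num.int -> `|x| < 1 -> x = 0.
Proof.
by move=> xi x1; apply: contraTeq x1 => /norm_intr_ge1; rewrite -leNgt; exact.
Qed.

(* The representative of [x] modulo 1 in ]-1/2, 1/2[; junk if there is none. *)
Definition mod1_rep (x : R) : R := xget 0 [set d | `|d| < 2^-1 /\ x - d \is a Num.int].

Lemma mod1_repE (x d : R) : `|d| < 2^-1 -> x - d \is a Num.int -> mod1_rep x = d.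
Proof.
move=> d1 xd; apply: xget_unique => // d' [d'1 xd'].
apply/eqP; rewrite -subr_eq0; apply/eqP/int_norm_lt1.
  by rewrite (_ : d' - d = (x - d) - (x - d')); [exact: rpredB | lra].
apply: (le_lt_trans (ler_normB _ _)); lra.
Qed.

(** Continuity of the class of [h] in R/Z. The function itself may jump by integers, as a function
    on the surface does when it is read through [repr]. *)
Definition mod1_continuous (T : topologicalType) (h : T -> R) :=
  forall t e, 0 < e ->
    \forall u \near t, exists2 d, `|d| < e & h u - h t - d \is a Num.int.

Lemma mod1_continuous_comp (S T : topologicalType) (f : S -> T) (h : T -> R) :
  continuous f -> mod1_continuous h -> mod1_continuous (h \o f).
Proof. by move=> cf ch t e e0; exact: (cf t _ (ch (f t) e e0)). Qed.

Lemma mod1_rep_continuous (T : topologicalType) (h1 h2 : T -> R) :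
  mod1_continuous h1 -> mod1_continuous h2 ->
  (forall t, exists2 d, `|d| < 4^-1 & h1 t - h2 t - d \is a Num.int) ->
  continuous (fun t => mod1_rep (h1 t - h2 t)).
Proof.
move=> c1 c2 c12 t; apply/cvgrPdist_lt => e e0.
(* Two errors [e'] add up to at most [e], for continuity, and to at most 1/4, which keeps
   [d + (d1 - d2)] in ]-1/2, 1/2[, where representatives are unique. *)
pose e' := Num.min e 4^-1 / 2.
have e'0 : 0 < e' by rewrite /e' divr_gt0// lt_min e0 /= invr_gt0.
have [d d4 hd] := c12 t.
have -> : mod1_rep (h1 t - h2 t) = d by apply: mod1_repE => //; lra.
have e'e : e' + e' <= e by rewrite /e' -splitr ge_min lexx.
have e'4 : e' + e' <= 4^-1 by rewrite /e' -splitr ge_min lexx orbT.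
near=> u.
have [d1 d1e h1u] : exists2 d, `|d| < e' & h1 u - h1 t - d \is a Num.int.
  by near: u; exact: c1.
have [d2 d2e h2u] : exists2 d, `|d| < e' & h2 u - h2 t - d \is a Num.int.
  by near: u; exact: c2.
have d12 : `|d1 - d2| < e' + e' by apply: (le_lt_trans (ler_normB _ _)); lra.
rewrite (@mod1_repE _ (d + (d1 - d2))).
- by rewrite opprD addNKr normrN (lt_le_trans d12).
- by apply: (le_lt_trans (ler_normD _ _)); lra.
- rewrite (_ : _ - _ = (h1 t - h2 t - d) + ((h1 u - h1 t - d1) - (h2 u - h2 t - d2))).
    by apply: rpredD => //; exact: rpredB.
  lra.
Unshelve. all: by end_near. Qed.

(** By compactness, [h s] and [h t] are within 1/4 modulo 1 uniformly on [K] for [s] near [t]. A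
    lift of one then gives a lift of the other by adding the small representative of the difference,
    and continuous induction carries the lift from time 0 to time 1. *)
Lemma mod1_homotopy_lift (K : topologicalType) (h : R -> K -> R) :
  compact [set: K] -> mod1_continuous (fun p : R * K => h p.1 p.2) ->
  (exists2 H : K -> R, continuous H & forall x : K, H x - h 0 x \is a Num.int) ->
  exists2 H : K -> R, continuous H & forall x : K, H x - h 1 x \is a Num.int.
Proof.
move=> cK ch.
have chs s : mod1_continuous (h s).
  suff c : continuous (fun x : K => (s, x)) by exact: mod1_continuous_comp c ch.
  by move=> x; exact: (cvg_pair (cvg_cst s) cvg_id).
have near_h t : \forall s \near t, forall x : K,
    exists2 d, `|d| < 4^-1 & h s x - h t x - d \is a Num.int.
  have /compact_near_coveringP W := cK.
  have W' := W _ (nbhs t) (fun (s : R) (u : K) =>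
    exists2 d, `|d| < 4^-1 & h s u - h t u - d \is a Num.int) (nbhs_filter t).
  apply: (filterS _ (W' _)) => [s Hs u|x _]; first exact: Hs.
    (* Both [h s y] and [h t y] are compared with [h t x], so two errors of 1/8 make up the required
       1/4. *)
    have /(ch (t, x)) : (0 : R) < 8^-1 by rewrite invr_gt0.
    case=> -[A B] /= [At Bx] AB.
    exists (B, A) => //= -[y s] [/= By As].
    have [d1 d1e h1] := AB (s, y) (conj As By).
    have [d2 d2e h2] := AB (t, y) (conj (nbhs_singleton At) By).
    exists (d1 - d2).
      by apply: (le_lt_trans (ler_normB _ _)); lra.
    rewrite (_ : _ - _ = (h s y - h t x - d1) - (h t y - h t x - d2)).
      exact: rpredB.
    lra.

have step s t : (forall x : K,
    exists2 d, `|d| < 4^-1 & h s x - h t x - d \is a Num.int) ->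
   (exists2 H : K -> R, continuous H & forall x : K, H x - h t x \is a Num.int) ->
   (exists2 H : K -> R, continuous H & forall x : K, H x - h s x \is a Num.int).
  move=> hst [H cH Hh].
  exists (fun x => H x + mod1_rep (h s x - h t x)).
    by move=> x; apply: cvgD; [exact: cH | exact: mod1_rep_continuous].
  move=> x; have [d d4 hd] := hst x.
  rewrite (@mod1_repE _ d)//; last by lra.
  by rewrite (_ : _ - _ = (H x - h t x) - (h s x - h t x - d)); [exact: rpredB | lra].
move=> H0.
apply: (@real_induction R (fun t => exists2 H : K -> R, continuous H &
  forall x : K, H x - h t x \is a Num.int) 0 1) => //.
- move=> t _ Ht; apply: cvg_within; near=> s; apply: step Ht.
  by near: s; exact: near_h.
- move=> t /andP[t0 _] Hs.
  have [s [st s0 hs]] : exists s, [/\ s < t, 0 <= s & forall x : K,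
      exists2 d, `|d| < 4^-1 & h s x - h t x - d \is a Num.int].
    have W : \forall s \near t^'-, [/\ s < t, 0 <= s & forall x : K,
      exists2 d, `|d| < 4^-1 & h s x - h t x - d \is a Num.int].
      near=> s; split.
      - by near: s; exact: nbhs_left_lt.
      - by near: s; exact: nbhs_left_ge.
      - by near: s; apply: cvg_within; exact: near_h.
    exact: filter_ex W.
  apply: (step _ s); last by apply: Hs; rewrite s0.
  move=> x; have [d d4 hd] := hs x; exists (- d); first by rewrite normrN.
  by rewrite (_ : _ - _ = - (h s x - h t x - d)); [rewrite rpredN | lra].
Unshelve. all: by end_near. Qed.

(** The difference of two lifts is continuous with integral values, hence locally constant, hence
    constant by continuous induction. *)
Lemma mod1_lift_uniq (a b : R) (f g h : R -> R) : a <= b ->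
  {within `[a, b], continuous f} -> {within `[a, b], continuous g} ->
  (forall t, a <= t <= b -> f t - h t \is a Num.int) ->
  (forall t, a <= t <= b -> g t - h t \is a Num.int) ->
  f b - f a = g b - g a.
Proof.
move=> ab cf cg fh gh.
pose D t := f t - g t.
have cD : {within `[a, b], continuous D}.
  by move=> t; apply: cvgB; [exact: cf | exact: cg].
have Di t : a <= t <= b -> D t \is a Num.int.
  move=> tab; rewrite (_ : D t = (f t - h t) - (g t - h t)).
    by apply: rpredB; [exact: fh | exact: gh].
  by rewrite /D; lra.
suff : D b = D a by rewrite /D; lra.
have near1 t : a <= t <= b ->
    \forall s \near t, a <= s <= b -> D s = D t.
  move=> tab.
  have /subspace_continuousP := cD.
  move=> /(_ t); rewrite /= in_itv /= => /(_ tab) /cvgrPdist_lt /(_ 1 ltr01).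
  rewrite near_withinE; apply: filterS => s Hs sab.
  apply/eqP; rewrite -subr_eq0; apply/eqP/int_norm_lt1; first by apply: rpredB; exact: Di.
  by rewrite distrC; apply: Hs; rewrite /= in_itv.
apply: (@real_induction R (fun t => D t = D a) a b) => //.
- move=> t /andP[at1 tb] Dt.
  near=> s; rewrite -Dt.
  have : a <= s <= b.
    apply/andP; split; last by near: s; exact: nbhs_right_ltW.
    by apply: (le_trans at1); near: s; exact: nbhs_right_ge.
  by near: s; apply: cvg_within; apply: near1; rewrite at1 ltW.
- move=> t /andP[at1 tb] Ds.
  have : \forall s \near t^'-, a <= s < t /\ D s = D t.
    near=> s.
    have ast : a <= s < t.
      by apply/andP; split; near: s; [exact: nbhs_left_ge|exact: nbhs_left_lt].
    split => //.
    have : a <= s <= b by case/andP: ast => -> /= /ltW/le_trans; exact.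
    by near: s; apply: cvg_within; apply: near1; rewrite tb ltW.
  by move=> /filter_ex[s [/Ds <- ->]].
Unshelve. all: by end_near. Qed.

End Mod1.

(** * Chains and cochains *)

Section FreegLift.
Variables (R : nzRingType) (K : choiceType) (M : lmodType R) (f : K -> M).

Lemma fglift_is_linear : linear (fglift f : {freeg K / R} -> M).
Proof.
move=> c D E; have fB := lift_is_additive f.
have f0 : fglift f 0 = 0 by rewrite -[0](subrr 0) fB subrr.
have fN A : fglift f (- A) = - fglift f A by rewrite -[- A]sub0r fB f0 sub0r.
have fD A B : fglift f (A + B) = fglift f A + fglift f B.
  by have := fB A (- B); rewrite opprK fN opprK.
rewrite fD; congr (_ + _); rewrite -(freeg_sumE D).
elim: (dom D) => [|k s IH]; first by rewrite big_nil scaler0 f0 scaler0.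
rewrite big_cons scalerDr !fD IH scalerDr; congr (_ + _).
have -> : c *: << coeff k D *g k >> = << c * coeff k D *g k >> :> {freeg K / R}.
  by apply/eqP/freeg_eqP => z; rewrite coeffZ !coeffU mulrA.
by rewrite !liftU scalerA.
Qed.

HB.instance Definition _ := GRing.isLinear.Build R {freeg K / R} M *:%R
  (fglift f : {freeg K / R} -> M) fglift_is_linear.

Lemma fgliftU x : fglift f << x >> = f x.
Proof. by rewrite liftU scale1r. Qed.

End FreegLift.

Lemma fglift_comp (R : nzRingType) (K : choiceType) (M N : lmodType R)
    (f : K -> M) (g : {linear M -> N}) (D : {freeg K / R}) :
  g (fglift f D) = fglift (g \o f) D.
Proof.
rewrite -(freeg_sumE D) !linear_sum.
by apply: eq_bigr => k _; rewrite /= !liftU linearZ.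
Qed.

Section Chains.
Variables (R : realType) (X : topologicalType).
Implicit Types (phi psi : cochain R X 1).

HB.instance Definition _ k (phi : cochain R X k) :=
  GRing.Linear.copy (pairing phi : chain R X k -> R^o) (fglift (phi : _ -> R^o)).
HB.instance Definition _ k :=
  GRing.Linear.copy (@boundary R X k) (fglift (fun s : singular_simplex R X k.+1 =>
    \sum_(i < k.+2) (-1) ^+ i *: (<< face i s >> : chain R X k))).

Lemma pairingU k (phi : cochain R X k) s : pairing phi << s >> = phi s.
Proof. exact: fgliftU. Qed.

Lemma boundaryU k (s : singular_simplex R X k.+1) :
  boundary << s >> = \sum_(i < k.+2) (-1) ^+ i *: (<< face i s >> : chain R X k).
Proof. exact: fgliftU. Qed.

Lemma boundary2U (s : singular_simplex R X 2) :
  boundary << s >> = << face 0 s >> - << face 1 s >> + << face ord_max s >>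
    :> chain R X 1.
Proof.
rewrite boundaryU !big_ord_recl big_ord0 addr0 expr0 scale1r expr1 scaleN1r.
rewrite sqrrN expr1n scale1r addrA; congr (_ - _ + _); congr << face _ s >>;
  exact/val_inj.
Qed.

Lemma pairing_boundary phi (c : chain R X 2) :
  pairing phi (boundary c) =
  pairing (fun s => phi (face 0 s) - phi (face 1 s) + phi (face ord_max s)) c.
Proof.
rewrite /pairing [boundary c]/(fglift _ c) [LHS]fglift_comp; congr fglift.
apply/funext => s /=.
by rewrite -boundaryU boundary2U raddfD raddfB /= !fgliftU.
Qed.

Lemma cocycleP phi : cocycle phi <->
  forall s : singular_simplex R X 2,
    phi (face 1 s) = phi (face ord_max s) + phi (face 0 s).
Proof.
split=> [phi0 s|phi0 c].
  have := phi0 << s >>; rewrite pairing_boundary pairingU => e; lra.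
rewrite pairing_boundary [X in pairing X](_ : _ = fun=> 0).
  rewrite /pairing -(freeg_sumE c) linear_sum big1 // => k _.
  by rewrite /= liftU scaler0.
by apply/funext => s; rewrite phi0; lra.
Qed.

Lemma pairing_homologous phi (z w : chain R X 1) :
  cocycle phi -> homologous z w -> pairing phi z = pairing phi w.
Proof.
move=> phi0 [c zw]; apply/eqP; rewrite -subr_eq0 -raddfB zw; exact/eqP/phi0.
Qed.

(** Through this adjunction the periods of a cycle homologous to [cap m phi] are read off the cup
    product form. *)
Lemma pairing_cap (m : chain R X 2) phi psi :
  pairing psi (cap m phi) = pairing (cup phi psi) m.
Proof.
rewrite /pairing /cap [LHS]fglift_comp; congr fglift.
by apply/funext => s /=; rewrite linearZ /= fgliftU.
Qed.

End Chains.

(** * Winding cocycles *)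

Section Simplex.
Variable R : realType.

(** Clamping the parameter makes segments total functions on R that stay in the simplex or in the
    polygon. *)
Definition clamp (t : R) : R := Num.max 0 (Num.min t 1).

Lemma clamp_id t : 0 <= t <= 1 -> clamp t = t.
Proof. by case/andP=> t0 t1; rewrite /clamp min_l // max_r. Qed.

Lemma clamp_itv t : 0 <= clamp t <= 1.
Proof. by rewrite /clamp le_max lexx /= ge_max ler01 ge_min lexx orbT. Qed.

Lemma clamp_continuous : continuous clamp.
Proof.
move=> t; have c := @cst_continuous.
have m := @continuous_min R R id (fun=> 1) t (@cvg_id _ _) (@c _ _ _ t).
exact: (@continuous_max R R (fun=> 0) _ t (@c _ _ _ t) m).
Qed.

Lemma std_simplex_convex k (v w : std_simplex R k) (t : R) :
  std_simplex R k ((1 - clamp t) *: val v + clamp t *: val w).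
Proof.
have /andP[t0 t1] := clamp_itv t.
have [v0 v1] := set_valP v; have [w0 w1] := set_valP w.
split=> [i|].
  by rewrite !mxE addr_ge0 // mulr_ge0 ?subr_ge0.
under eq_bigr do rewrite !mxE.
by rewrite big_split -!mulr_sumr /= v1 w1 !mulr1 subrK.
Qed.

Definition segm k (v w : std_simplex R k) (t : R) : std_simplex R k :=
  exist (fun x => x \in std_simplex R k) _ (mem_set (std_simplex_convex v w t)).

Lemma segm0 k (v w : std_simplex R k) : segm v w 0 = v.
Proof.
by apply/val_inj; rewrite /= clamp_id ?lexx ?ler01// subr0 scale1r scale0r addr0.
Qed.

Lemma segm1 k (v w : std_simplex R k) : segm v w 1 = w.
Proof.
by apply/val_inj; rewrite /= clamp_id ?lexx ?ler01// subrr scale1r scale0r add0r.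
Qed.

Lemma segm_continuous k (v : std_simplex R k) :
  continuous (fun p : R * std_simplex R k => segm v p.2 p.1).
Proof.
apply: continuous_comp_initial => -[t w].
have ct : (clamp \o fst) x @[x --> (t, w)] --> clamp t.
  by apply: continuous_comp; [exact: cvg_fst | exact: clamp_continuous].
apply: cvgD; apply: cvgZ => //=.
- by apply: cvgB => //; exact: cvg_cst.
- exact: cvg_cst.
- apply: (@cvg_comp _ _ _ snd (fun w : std_simplex R k => val w) _ (nbhs w)).
    exact: cvg_snd.
  exact: initial_continuous.
Qed.

Lemma std_simplex_compact k : compact [set: std_simplex R k].
Proof.
have cS : compact (std_simplex R k).
  have -> : std_simplex R k =
      [set v : 'rV[R]_k.+1 | forall i, `[0, 1]%classic (v 0 i)] `&`
      ((fun v : 'rV[R]_k.+1 => \sum_i v 0 i) @^-1` [set 1]).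
    apply/seteqP; split => v /= [v0 v1]; split => //= i.
      rewrite in_itv /= v0 -v1 (bigD1 i) //= lerDl sumr_ge0 //.
    by have := v0 i; rewrite in_itv /= => /andP[].
  apply: compact_closedI.
    by apply: (@rV_compact R _ (fun=> `[0, 1]%classic)) => i; exact: segment_compact.
  apply: (closed_comp _ (@closed_eq _ 1)) => v _.
  apply: continuous_big => [|i _]; first exact: add_continuous.
  exact: coord_continuous.
move=> F PF _.

(* Compactness is known for the set of row vectors. A cluster point of the image filter comes back
   to the subtype, whose open sets are the preimages of open sets of row vectors. *)
pose G := (fun v : std_simplex R k => (val v : 'rV[R]_k.+1)) @ F.
have [v [Sv clv]] : std_simplex R k `&` cluster G !=set0.
  apply: cS; rewrite /G /fmap /=.
  by apply: filterS (@filterT _ F _) => v _; exact: set_valP.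
exists (exist (fun x => x \in std_simplex R k) v (mem_set Sv)); split => // A B FA.
move=> [_ [[C oC <-] /= Cv sB]].
have GA : G [set val w | w in A].
  by apply: (@filterS _ F _ A _ _ FA) => w Aw; exists w.
have [_ [[w Aw <-] Cw]] := clv _ _ GA (open_nbhs_nbhs (conj oC Cv)).
by exists w; split => //; exact: sB.
Qed.

Lemma vertex_simplex k (i : 'I_k.+1) :
  std_simplex R k (\row_j (j == i)%:R).
Proof.
split=> [j|]; first by rewrite mxE ler0n.
under eq_bigr do rewrite mxE.
by rewrite (bigD1 i) //= eqxx big1 ?addr0 // => j /negbTE ->.
Qed.

Definition vertex k (i : 'I_k.+1) : std_simplex R k :=
  exist (fun x => x \in std_simplex R k) _ (mem_set (vertex_simplex i)).

Lemma face_map_vertex k (i : 'I_k.+2) (j : 'I_k.+1) :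
  face_map i (vertex j) = vertex (lift i j).
Proof.
apply/val_inj/rowP => l; rewrite /= !mxE.
case: unliftP => [l' ->|->]; first by rewrite mxE (inj_eq lift_inj).
by rewrite (negbTE (neq_lift _ _)).
Qed.

(** The contraction of the simplex onto its vertex 0 is a homotopy from a constant, which lifts
    trivially, to [h]. *)
Lemma mod1_simplex_lift k (h : std_simplex R k -> R) : mod1_continuous h ->
  exists2 H : std_simplex R k -> R, continuous H &
    forall v, H v - h v \is a Num.int.
Proof.
move=> ch; pose v0 : std_simplex R k := vertex 0.
have [|||H cH Hh] := @mod1_homotopy_lift R (std_simplex R k)
  (fun t v => h (segm v0 v t)).
- exact: std_simplex_compact.
- exact: (mod1_continuous_comp (@segm_continuous k v0) ch).
- exists (fun=> h v0); first by move=> v; apply: cst_continuous.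
  by move=> v; rewrite segm0 subrr rpred0.
by exists H => // v; have := Hh v; rewrite segm1.
Qed.

Section Winding.
Variables (X : topologicalType) (h : X -> R).

(** The cocycle pulled back from the circle R/Z by the class of [h]. For [h] continuous modulo 1 a
    lift always exists, so the default 0 is not reached. *)
Definition winding : cochain R X 1 := fun s =>
  xget 0 [set d | exists H : std_simplex R 1 -> R,
    [/\ continuous H, forall v, H v - h (s v) \is a Num.int
      & d = H (vertex 1) - H (vertex 0)]].

Lemma windingE (s : singular_simplex R X 1) (H : std_simplex R 1 -> R) :
  continuous H -> (forall v, H v - h (s v) \is a Num.int) ->
  winding s = H (vertex 1) - H (vertex 0).
Proof.
move=> cH Hs; apply: xget_unique; first by exists H.
move=> _ [H' [cH' H's ->]].
pose g := segm (vertex 0 : std_simplex R 1) (vertex 1).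
have cg : continuous g.
  move=> t; exact: (@continuous_comp _ _ _ (fun t : R => (t, vertex 1)) _ t
    (cvg_pair cvg_id (cvg_cst _)) (@segm_continuous 1 _ (t, vertex 1))).
have cw (f : std_simplex R 1 -> R) : continuous f ->
    {within `[0, 1], continuous (f \o g)}.
  move=> cf; apply: continuous_subspaceT => t.
  by apply: continuous_comp; [exact: cg | exact: cf].
have := @mod1_lift_uniq R 0 1 (H' \o g) (H \o g) (h \o s \o g) ler01
  (cw _ cH') (cw _ cH) (fun t _ => H's _) (fun t _ => Hs _).
by rewrite /= /g segm0 segm1.
Qed.

Hypothesis ch : mod1_continuous h.

Lemma mod1_continuous_simplex k (s : singular_simplex R X k) :
  mod1_continuous (h \o s).
Proof. by apply: mod1_continuous_comp ch; exact: cts_fun. Qed.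

(** A lift over the whole 2-simplex restricts to lifts over its three faces, so the windings of the
    faces are differences of the same three vertex values. *)
Lemma winding_cocycle : cocycle winding.
Proof.
apply/cocycleP => s.
have [H cH Hs] := mod1_simplex_lift (mod1_continuous_simplex s).
have w i : winding (face i s) =
    H (vertex (lift i 1)) - H (vertex (lift i 0)).
  rewrite (@windingE _ (H \o face_map i)).
  - by rewrite /= !face_map_vertex.
  - move=> v.
    by apply: continuous_comp; [exact: face_map_continuous | exact: cH].
  - by move=> v; exact: (Hs (face_map i v)).
rewrite !w.
have -> : lift (1 : 'I_3) (1 : 'I_2) = lift 0 1 by exact/val_inj.
have -> : lift (1 : 'I_3) (0 : 'I_2) = lift ord_max 0 by exact/val_inj.
have -> : lift (0 : 'I_3) (0 : 'I_2) = lift ord_max 1 by exact/val_inj.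
by lra.
Qed.

End Winding.
End Simplex.

(** * Neighbourhoods in the surface *)

Section Gap.
Variable R : realType.
Implicit Types a c d t k : R.

(** The sides of the polygon lie on lines with integral equations. Weak inequalities with an integer
    pass from any point within [d] of [c] to [c] itself, so a side met near a gapped point already
    contains it. *)
Definition gapped d c := forall k, k \is a Num.int -> `|c - k| < d -> c = k.

Lemma gapped_exists c : exists2 d, 0 < d & gapped d c.
Proof.
have [ci|cni] := boolP (c \is a Num.int).
  exists 1 => // k ki ck; apply/eqP; rewrite -subr_eq0; apply/eqP/int_norm_lt1 => //.
  exact: rpredB.
have fl := floor_le c; have lf := floorD1_gt c.
set m : R := (Num.floor c)%:~R in fl.
have lf' : c < m + 1 by rewrite /m -intrD1.
have mc : m < c.
  by rewrite lt_neqAle fl andbT; apply: contraNneq cni => <-; exact: intr_int.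
exists (Num.min (c - m) (m + 1 - c)); first by rewrite lt_min !subr_gt0 mc.
move=> k ki; rewrite lt_min => /andP[]; rewrite !ltr_norml => /andP[h1 h2] /andP[h3 h4].
have : k - m = 0.
  apply: int_norm_lt1; first by rewrite rpredB // intr_int.
  by rewrite ltr_norml; apply/andP; split; lra.
lra.
Qed.

Lemma gappedD d c c' : c - c' \is a Num.int -> gapped d c -> gapped d c'.
Proof.
move=> cc' gc k ki ck.
have := gc (k + (c - c')) (rpredD ki cc').
rewrite (_ : c - _ = c' - k); last by lra.
by move=> /(_ ck); lra.
Qed.

Lemma gapped_le d a t k : k \is a Num.int -> gapped d a -> `|t - a| < d ->
  t <= k -> a <= k.
Proof.
move=> ki ga; rewrite ltr_norml => /andP[h1 h2] tk; rewrite leNgt; apply/negP => ka.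
suff /(ga k ki) : `|a - k| < d by lra.
by rewrite ger0_norm; lra.
Qed.

Lemma gapped_ge d a t k : k \is a Num.int -> gapped d a -> `|t - a| < d ->
  k <= t -> k <= a.
Proof.
move=> ki ga; rewrite ltr_norml => /andP[h1 h2] tk; rewrite leNgt; apply/negP => ka.
suff /(ga k ki) : `|a - k| < d by lra.
by rewrite ler0_norm; lra.
Qed.

End Gap.

Section Surface.
Variables (R : realType) (n : nat).
Local Notation glued := (@glued R n).
Local Notation Lpoly := (Lpoly R n).
Local Notation Lproj := (@Lproj R n).
Local Notation Lsurface := (Lsurface R n).
Local Notation N := (n.+1%:R : R).

Definition mkL (p : R * R) (h : Lpoly p) : Lpoly :=
  exist (fun p => p \in Lpoly) p (mem_set h).

Lemma LprojP (p q : Lpoly) : Lproj p = Lproj q <->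
  clos_refl_sym_trans Lpoly (fun p q => glued (val p) (val q)) p q.
Proof.
split=> [/eqmodP /asboolP //|h]; apply/eqmodP; exact/asboolP.
Qed.

Lemma Lproj_repr (x : Lsurface) : Lproj (repr x) = x.
Proof. exact: reprK. Qed.

Lemma glued_poly p q : glued p q -> Lpoly p /\ Lpoly q.
Proof.
have N1 := @le1n R n.
rewrite /Defs.Lpoly /box /=.
case=> t [] [/andP[t0 t1] [-> ->]]; split; rewrite /setU /setX /= !in_itv /=;
 ((by left; split; apply/andP; split => //; lra) ||
  (by right; split; apply/andP; split => //; lra)).
Qed.

(** Equivalently, the class of [F] in R/Z descends to the surface. *)
Definition glue_invariant (F : R * R -> R) :=
  forall p q, glued p q -> F p - F q \is a Num.int.

Lemma Lproj_invariant F (p q : Lpoly) : glue_invariant F ->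
  Lproj p = Lproj q -> F (val p) - F (val q) \is a Num.int.
Proof.
move=> gF /LprojP; elim=> {p q} [p q /gF //|p|p q _ h|p q r _ h1 _ h2].
- by rewrite subrr rpred0.
- by rewrite -opprB rpredN.
- by rewrite (_ : _ - _ = (F (val p) - F (val q)) + (F (val q) - F (val r)));
    [exact: rpredD | lra].
Qed.

Lemma glue_invariant_fst : glue_invariant fst.
Proof.
by move=> p q [t [] [_ [-> ->]]] /=;
  rewrite ?subrr ?sub0r ?rpredN ?rpred0 ?rpred1 ?rpred_nat.
Qed.

Lemma glue_invariant_snd : glue_invariant snd.
Proof.
by move=> p q [t [] [_ [-> ->]]] /=;
  rewrite ?subrr ?sub0r ?rpredN ?rpred0 ?rpred1 ?rpred_nat.
Qed.

Definition close d (p q : R * R) := `|p.1 - q.1| < d /\ `|p.2 - q.2| < d.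

(** By the gaps, [p0] lies on the same side of the polygon as [p], so the translation that takes [p]
    to [q] also glues [p0], and translations preserve closeness. *)
Lemma glued_close d p q p0 : glued p q -> close d p p0 ->
  gapped d p0.1 -> gapped d p0.2 ->
  exists2 q0, glued p0 q0 & close d q q0.
Proof.
move: p0 => -[a b] + [+ +] ga gb.
have Ni : N \is a Num.int by rewrite rpred_nat.
have i0 : (0 : R) \is a Num.int by rewrite rpred0.
have i1 : (1 : R) \is a Num.int by rewrite rpred1.
move=> [t [] [/andP[t0 t1] [-> ->]]] /= ta tb.
all: have d0 : 0 < d by exact: le_lt_trans (normr_ge0 _) ta.
- have b0 : b = 0 by apply/le_anti/andP; split;
    [exact: gapped_le tb _ | exact: gapped_ge tb _].
  exists (a, N); last by split; rewrite //= subrr normr0.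
  exists a; constructor 1; split; last by rewrite b0.
  by apply/andP; split; [exact: gapped_ge ta _ | exact: gapped_le ta _].
- have b0 : b = 0 by apply/le_anti/andP; split;
    [exact: gapped_le tb _ | exact: gapped_ge tb _].
  exists (a, 1); last by split; rewrite //= subrr normr0.
  exists a; constructor 2; split; last by rewrite b0.
  by apply/andP; split; [exact: gapped_ge ta _ | exact: gapped_le ta _].
- have a0 : a = 0 by apply/le_anti/andP; split;
    [exact: gapped_le ta _ | exact: gapped_ge ta _].
  exists (N, b); last by split; rewrite //= subrr normr0.
  exists b; constructor 3; split; last by rewrite a0.
  by apply/andP; split; [exact: gapped_ge tb _ | exact: gapped_le tb _].
- have a0 : a = 0 by apply/le_anti/andP; split;
    [exact: gapped_le ta _ | exact: gapped_ge ta _].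
  exists (1, b); last by split; rewrite //= subrr normr0.
  exists b; constructor 4; split; last by rewrite a0.
  by apply/andP; split; [exact: gapped_ge tb _ | exact: gapped_le tb _].
Qed.

Lemma glued_closeV d p q q0 : glued p q -> close d q q0 ->
  gapped d q0.1 -> gapped d q0.2 ->
  exists2 p0, glued p0 q0 & close d p p0.
Proof.
move: q0 => -[a b] + [+ +] ga gb.
have Ni : N \is a Num.int by rewrite rpred_nat.
have i0 : (0 : R) \is a Num.int by rewrite rpred0.
have i1 : (1 : R) \is a Num.int by rewrite rpred1.
move=> [t [] [/andP[t0 t1] [-> ->]]] /= ta tb.
all: have d0 : 0 < d by exact: le_lt_trans (normr_ge0 _) ta.
- have b0 : b = N by apply/le_anti/andP; split;
    [exact: gapped_le tb _ | exact: gapped_ge tb _].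
  exists (a, 0); last by split; rewrite //= subrr normr0.
  exists a; constructor 1; split; last by rewrite b0.
  by apply/andP; split; [exact: gapped_ge ta _ | exact: gapped_le ta _].
- have b0 : b = 1 by apply/le_anti/andP; split;
    [exact: gapped_le tb _ | exact: gapped_ge tb _].
  exists (a, 0); last by split; rewrite //= subrr normr0.
  exists a; constructor 2; split; last by rewrite b0.
  by apply/andP; split; [exact: gapped_ge ta _ | exact: gapped_le ta _].
- have a0 : a = N by apply/le_anti/andP; split;
    [exact: gapped_le ta _ | exact: gapped_ge ta _].
  exists (0, b); last by split; rewrite //= subrr normr0.
  exists b; constructor 3; split; last by rewrite a0.
  by apply/andP; split; [exact: gapped_ge tb _ | exact: gapped_le tb _].
- have a0 : a = 1 by apply/le_anti/andP; split;
    [exact: gapped_le ta _ | exact: gapped_ge ta _].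
  exists (0, b); last by split; rewrite //= subrr normr0.
  exists b; constructor 4; split; last by rewrite a0.
  by apply/andP; split; [exact: gapped_ge tb _ | exact: gapped_le tb _].
Qed.

(* For points of the polygon: both lie in the corner square, both in the upper
   arm, or both in the right arm. *)
Definition same_piece (p q : R * R) :=
  [\/ [/\ p.1 <= 1, p.2 <= 1, q.1 <= 1 & q.2 <= 1],
      [/\ p.1 <= 1, 1 <= p.2, q.1 <= 1 & 1 <= q.2]
    | [/\ 1 <= p.1, p.2 <= 1, 1 <= q.1 & q.2 <= 1]].

Lemma close_same_piece d (p : Lpoly) q : close d (val p) q ->
  gapped d q.1 -> gapped d q.2 -> same_piece (val p) q.
Proof.
move=> [pq1 pq2] g1 g2; have i1 : (1 : R) \is a Num.int by rewrite rpred1.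
have /= := set_valP p; rewrite /Defs.Lpoly /box /setU /setX /= !in_itv /=.
case=> -[/andP[x0 x1] /andP[y0 y1]].
- have [h|/ltW h] := leP (val p).2 1; [constructor 1 | constructor 2]; split => //;
   by [exact: gapped_le pq1 _ | exact: gapped_le pq2 _ | exact: gapped_ge pq2 _].
- have [h|/ltW h] := leP (val p).1 1; [constructor 1 | constructor 3]; split => //;
   by [exact: gapped_le pq1 _ | exact: gapped_le pq2 _ | exact: gapped_ge pq1 _].
Qed.

(** This replaces charts and treats the conical point like any other. The set [W] of polygon points
    close to some preimage of [x0] is open and saturated for the gluing, so its image is a
    neighbourhood of [x0]. *)
Lemma near_same_piece (x0 : Lsurface) e : 0 < e ->
  \forall x \near x0, exists p p0 : Lpoly,
    [/\ Lproj p = x, Lproj p0 = x0, close e (val p) (val p0)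
      & same_piece (val p) (val p0)].
Proof.
move=> e0; pose q0 : Lpoly := repr x0.
have [d1 d10 g1] := gapped_exists (val q0).1.
have [d2 d20 g2] := gapped_exists (val q0).2.
pose d := Num.min e (Num.min d1 d2).
have d0 : 0 < d by rewrite !lt_min e0 d10.
(* The coordinates of the preimages of [x0] differ by integers, so one [d] is a gap for all of
   them. *)
have g p0 : Lproj p0 = x0 -> gapped d (val p0).1 /\ gapped d (val p0).2.
  rewrite -[x0]Lproj_repr => /esym E.
  split=> k ki; rewrite !lt_min => /and3P[_ h1 h2].
    exact: (gappedD (Lproj_invariant glue_invariant_fst E) g1).
  exact: (gappedD (Lproj_invariant glue_invariant_snd E) g2).
pose W := [set p : Lpoly | exists p0 : Lpoly,
  Lproj p0 = x0 /\ close d (val p) (val p0)].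
have Wglue (p q : Lpoly) : glued (val p) (val q) -> W p <-> W q.
  move=> pq; split=> -[p0 [p0x cl]]; have [g01 g02] := g _ p0x.
    have [r gl cl'] := glued_close pq cl g01 g02.
    have [_ Lr] := glued_poly gl.
    exists (mkL Lr); split => //; rewrite -p0x; apply/LprojP.
    by apply: rst_sym; apply: rst_step.
  have [r gl cl'] := glued_closeV pq cl g01 g02.
  have [Lr _] := glued_poly gl.
  exists (mkL Lr); split => //; rewrite -p0x; apply/LprojP.
  exact: rst_step.
have Wproj (p q : Lpoly) : Lproj p = Lproj q -> W p <-> W q.
  move=> /LprojP; elim=> {p q} [p q /Wglue //|p //|p q _ h|p q r _ h1 _ h2].
    by split=> /h.
  by split=> [/h1/h2|/h2/h1].
have oW : open W.
  rewrite openE => p [p0 [p0x [cl1 cl2]]].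
  have c1 : (val (q : Lpoly)).1 @[q --> p] --> (val p).1.
    apply: (@cvg_comp _ _ _ (fun q : Lpoly => val q) fst _ (nbhs (val p))).
      exact: initial_continuous.
    exact: cvg_fst.
  have c2 : (val (q : Lpoly)).2 @[q --> p] --> (val p).2.
    apply: (@cvg_comp _ _ _ (fun q : Lpoly => val q) snd _ (nbhs (val p))).
      exact: initial_continuous.
    exact: cvg_snd.
  have lt0 (a b : R) : `|a - b| < d -> 0 < d - `|a - b| by rewrite subr_gt0.
  have /cvgrPdist_lt/(_ _ (lt0 _ _ cl1)) n1 := c1.
  have /cvgrPdist_lt/(_ _ (lt0 _ _ cl2)) n2 := c2.
  near=> q; exists p0; split => //; split.
    have : `|(val p).1 - (val q).1| < d - `|(val p).1 - (val p0).1| by near: q.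
    by have := ler_distD (val p).1 (val q).1 (val p0).1; rewrite (distrC (val q).1 (val p).1); lra.
  have : `|(val p).2 - (val q).2| < d - `|(val p).2 - (val p0).2| by near: q.
  by have := ler_distD (val p).2 (val q).2 (val p0).2; rewrite (distrC (val q).2 (val p).2); lra.
have oV : open [set x : Lsurface | exists2 p, W p & Lproj p = x].
  rewrite /open /= /quotient_open.
  rewrite [X in open X](_ : _ = W) //; apply/seteqP; split=> p /=.
    by case=> q Wq qp; exact/(Wproj _ _ qp).
  by move=> Wp; exists p.
have Vx0 : [set x : Lsurface | exists2 p, W p & Lproj p = x] x0.
  exists q0; last exact: Lproj_repr.
  exists q0; split; first exact: Lproj_repr.
  by split; rewrite subrr normr0.
apply: filterS (open_nbhs_nbhs (conj oV Vx0)) => x [p [p0 [p0x cl]] px].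
exists p, p0; have [g01 g02] := g _ p0x; split => //.
  by case: cl => h1 h2; split; [apply: lt_le_trans h1 _ | apply: lt_le_trans h2 _];
    rewrite /d ge_min lexx.
exact: close_same_piece cl g01 g02.
Unshelve. all: by end_near. Qed.

(** Replacing the values at [repr] by those at close representatives [p] and [p0] costs only
    integers, after which the Lipschitz bound applies. *)
Lemma glue_mod1_continuous F : glue_invariant F ->
  (forall p q, `|F p - F q| <= `|p.1 - q.1| + `|p.2 - q.2|) ->
  mod1_continuous (fun x : Lsurface => F (val (repr x))).
Proof.
move=> gF lF x0 e e0.
have e2 : 0 < e / 2 by rewrite divr_gt0.
apply: filterS (near_same_piece x0 e2) => x [p [p0 [px p0x [cl1 cl2] _]]].
exists (F (val p) - F (val p0)).
  by apply: (le_lt_trans (lF _ _)); rewrite [ltRHS]splitr ltrD.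
rewrite (_ : _ - _ = (F (val (repr x)) - F (val p)) -
  (F (val (repr x0)) - F (val p0))); last by lra.
by apply: rpredB; apply: Lproj_invariant gF _; rewrite Lproj_repr.
Qed.

End Surface.

(** * Length of piecewise smooth curves *)

Section Speed.
Variable R : realType.
Implicit Types (f g : R -> R) (a b e t u v : R).
Local Notation mu := (@lebesgue_measure R).

Lemma norm2_cauchy a b (x y C : R) : 0 <= C -> a ^+ 2 + b ^+ 2 <= C ^+ 2 ->
  `|a * x + b * y| <= C * Num.sqrt (x ^+ 2 + y ^+ 2).
Proof.
move=> C0 abC; rewrite -ler_sqr ?nnegrE ?mulr_ge0 ?sqrtr_ge0 //.
have xy : 0 <= x ^+ 2 + y ^+ 2 by rewrite addr_ge0 ?sqr_ge0.
rewrite real_normK ?num_real // exprMn sqr_sqrtr //.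
apply: (@le_trans _ _ ((a ^+ 2 + b ^+ 2) * (x ^+ 2 + y ^+ 2))).
  have := sqr_ge0 (a * y - b * x); nra.
exact: ler_wpM2r.
Qed.

Lemma norm2_triangle a b (x y : R) :
  Num.sqrt ((a + x) ^+ 2 + (b + y) ^+ 2) <=
  Num.sqrt (a ^+ 2 + b ^+ 2) + `|x| + `|y|.
Proof.
have ab : 0 <= a ^+ 2 + b ^+ 2 by rewrite addr_ge0 ?sqr_ge0.
rewrite -ler_sqr ?nnegrE ?addr_ge0 ?sqrtr_ge0 //.
rewrite sqr_sqrtr; last by rewrite addr_ge0 ?sqr_ge0.
set S := Num.sqrt _.
have S0 : 0 <= S := sqrtr_ge0 _.
have SS : S ^+ 2 = a ^+ 2 + b ^+ 2 by rewrite sqr_sqrtr.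
have aS : `|a| <= S by rewrite -sqrtr_sqr ler_wsqrtr // lerDl sqr_ge0.
have bS : `|b| <= S by rewrite -sqrtr_sqr ler_wsqrtr // lerDr sqr_ge0.
have ax : a * x <= S * `|x|.
  by apply: (le_trans (ler_norm _)); rewrite normrM ler_wpM2r.
have by_ : b * y <= S * `|y|.
  by apply: (le_trans (ler_norm _)); rewrite normrM ler_wpM2r.
have xx : `|x| ^+ 2 = x ^+ 2 by rewrite real_normK ?num_real.
have yy : `|y| ^+ 2 = y ^+ 2 by rewrite real_normK ?num_real.
have xy : 0 <= `|x| * `|y| by rewrite mulr_ge0.
nra.
Qed.

Lemma derivable_near_right f t e : derivable f t 1 -> 0 < e ->
  \forall s \near t^'+, `|f s - f t - (f^`()%classic t) * (s - t)| <= e * (s - t).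
Proof.
move=> df e0.
have : (h^-1 *: ((f \o shift t) (h *: 1) - f t)) @[h --> 0^'] --> f^`()%classic t.
  by rewrite derive1E.
move=> /cvgrPdist_lt /(_ _ e0) [d /= d0 hd].
exists d => //= s /= sd ts.
have st0 : 0 < s - t by rewrite subr_gt0.
have st1 : ball_ (fun x : R => `|x|) 0 d (s - t) by rewrite /= sub0r normrN distrC.
have st2 : s - t != 0 by rewrite gt_eqF.
have := hd (s - t) st1 st2; rewrite /= scaler1 subrK => h.
have -> : f s - f t - f^`()%classic t * (s - t) =
    - (f^`()%classic t - (s - t)^-1 *: (f s - f t)) * (s - t).
  by rewrite /GRing.scale /=; field.
by rewrite normrM normrN (gtr0_norm st0) ler_wpM2r ?ltW.
Qed.

Lemma smooth_derivable f t : smooth f -> derivable f t 1.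
Proof. by move=> /(_ 0%N t). Qed.

Lemma smooth_continuous f : smooth f -> continuous f.
Proof.
by move=> sf t; apply/differentiable_continuous/derivable1_diffP/smooth_derivable.
Qed.

Lemma smooth_derive_continuous f : smooth f -> continuous (f^`()%classic).
Proof.
move=> sf t; apply/differentiable_continuous/derivable1_diffP.
by have := sf 1%N t; rewrite derive1n1.
Qed.

Definition speed (f g : R -> R) t : R :=
  Num.sqrt ((f^`()%classic t) ^+ 2 + (g^`()%classic t) ^+ 2).

Lemma speed_ge0 f g t : 0 <= speed f g t.
Proof. exact: sqrtr_ge0. Qed.

Lemma smooth_speed_continuous f g : smooth f -> smooth g -> continuous (speed f g).
Proof.
move=> sf sg t.
have c : (f^`()%classic s ^+ 2 + g^`()%classic s ^+ 2) @[s --> t] -->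
    f^`()%classic t ^+ 2 + g^`()%classic t ^+ 2.
  by apply: cvgD; apply: cvgM; exact: smooth_derive_continuous.
exact: (continuous_comp c (@sqrt_continuous R _)).
Qed.

Lemma eq_in_speed f g (f0 g0 : R -> R) u v t : u < t < v ->
  {in `[u, v], f =1 f0} -> {in `[u, v], g =1 g0} -> speed f g t = speed f0 g0 t.
Proof.
move=> /andP[ut tv] ff gg.
have near_in : \forall s \near t, s \in `[u, v].
  near=> s; rewrite in_itv /=; apply/andP; split; apply/ltW; near: s.
    exact: lt_nbhsr.
  exact: lt_nbhsl.
rewrite /speed !derive1E (@near_eq_derive _ _ _ f f0) ?(@near_eq_derive _ _ _ g g0) //.
  by apply: filterS near_in => s /gg.
by apply: filterS near_in => s /ff.
Unshelve. all: by end_near. Qed.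

Lemma path_piece_right (Q : R -> R -> Prop) a (s : seq R) t :
  (forall i, (i < size s)%N -> Q (nth 0 (a :: s) i) (nth 0 (a :: s) i.+1)) ->
  a <= t < last a s -> exists u v, u <= t < v /\ Q u v.
Proof.
elim: s a => [|x s IH] a Qs /andP[at1 tl]; first by move: tl; rewrite ltNge at1.
have [tx|xt] := ltP t x.
  by exists a, x; rewrite at1 tx; split => //; exact: (Qs 0%N).
by apply: (IH x) => [i si|]; [exact: (Qs i.+1) | rewrite xt].
Qed.

Lemma path_piece_left (Q : R -> R -> Prop) a (s : seq R) t :
  (forall i, (i < size s)%N -> Q (nth 0 (a :: s) i) (nth 0 (a :: s) i.+1)) ->
  a < t <= last a s -> exists u v, u < t <= v /\ Q u v.
Proof.
elim: s a => [|x s IH] a Qs /andP[at1 tl]; first by move: tl; rewrite leNgt at1.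
have [tx|xt] := leP t x.
  by exists a, x; rewrite at1 tx; split => //; exact: (Qs 0%N).
by apply: (IH x) => [i si|]; [exact: (Qs i.+1) | rewrite xt].
Qed.

Lemma piecewise_smooth_right f t : piecewise_smooth f -> 0 <= t < 1 ->
  exists g v, [/\ smooth g, t < v & {in `[t, v], f =1 g}].
Proof.
move=> [s [_ /eqP s1] fs] t01; rewrite -s1 in t01.
have [u [v [/andP[ut tv] [g sg fg]]]] := path_piece_right
  (Q := fun u v => exists2 g, smooth g & {in `[u, v], f =1 g}) fs t01.
exists g, v; split => // x; rewrite in_itv /= => /andP[tx xv].
by apply: fg; rewrite in_itv /= xv (le_trans ut).
Qed.

Lemma piecewise_smooth_left f t : piecewise_smooth f -> 0 < t <= 1 ->
  exists g u, [/\ smooth g, u < t & {in `[u, t], f =1 g}].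
Proof.
move=> [s [_ /eqP s1] fs] t01; rewrite -s1 in t01.
have [u [v [/andP[ut tv] [g sg fg]]]] := path_piece_left
  (Q := fun u v => exists2 g, smooth g & {in `[u, v], f =1 g}) fs t01.
exists g, u; split => // x; rewrite in_itv /= => /andP[ux xt].
by apply: fg; rewrite in_itv /= ux (le_trans xt).
Qed.

Lemma piecewise_smooth2_right f g t : piecewise_smooth f -> piecewise_smooth g ->
  0 <= t < 1 -> exists (f0 g0 : R -> R) v, [/\ smooth f0, smooth g0, t < v,
    {in `[t, v], f =1 f0} & {in `[t, v], g =1 g0}].
Proof.
move=> pf pg t01; have [f0 [v [sf tv ff]]] := piecewise_smooth_right pf t01.
have [g0 [w [sg tw gg]]] := piecewise_smooth_right pg t01.
exists f0, g0, (Num.min v w); split => //; first by rewrite lt_min tv.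
all: move=> x; rewrite in_itv /= le_min => /and3P[tx xv xw].
  by apply: ff; rewrite in_itv /= tx.
by apply: gg; rewrite in_itv /= tx.
Qed.

Lemma piecewise_smooth2_left f g t : piecewise_smooth f -> piecewise_smooth g ->
  0 < t <= 1 -> exists (f0 g0 : R -> R) u, [/\ smooth f0, smooth g0, u < t,
    {in `[u, t], f =1 f0} & {in `[u, t], g =1 g0}].
Proof.
move=> pf pg t01; have [f0 [v [sf tv ff]]] := piecewise_smooth_left pf t01.
have [g0 [w [sg tw gg]]] := piecewise_smooth_left pg t01.
exists f0, g0, (Num.max v w); split => //; first by rewrite gt_max tv.
all: move=> x; rewrite in_itv /= ge_max => /andP[/andP[vx wx] xt].
  by apply: ff; rewrite in_itv /= vx.
by apply: gg; rewrite in_itv /= wx.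
Qed.

Lemma piecewise_smooth_continuous f : piecewise_smooth f ->
  {within `[0, 1], continuous f}.
Proof.
move=> pf; apply/continuous_within_itvP => //; split.
- move=> t; rewrite in_itv /= => /andP[t0 t1].
  apply/left_right_continuousP; split.
    have [|g [u [/smooth_continuous cg ut fg]]] := @piecewise_smooth_left f t pf.
      by rewrite t0 ltW.
    rewrite fg ?in_itv /= ?lexx ?ltW //.
    apply: cvg_trans (cvg_at_left_filter (cg t)).
    apply: near_eq_cvg; near=> s; rewrite fg // in_itv /=; apply/andP; split.
      by near: s; exact: nbhs_left_ge.
    by near: s; exact: nbhs_left_le.
  have [|g [u [/smooth_continuous cg ut fg]]] := @piecewise_smooth_right f t pf.
    by rewrite t1 ltW.
  rewrite fg ?in_itv /= ?lexx ?ltW //.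
  apply: cvg_trans (cvg_at_right_filter (cg t)).
  apply: near_eq_cvg; near=> s; rewrite fg // in_itv /=; apply/andP; split.
    by near: s; exact: nbhs_right_ge.
  by near: s; exact: nbhs_right_le.
- have [|g [u [/smooth_continuous cg ut fg]]] := @piecewise_smooth_right f 0 pf.
    by rewrite lexx ltr01.
  rewrite fg ?in_itv /= ?lexx ?ltW //.
  apply: cvg_trans (cvg_at_right_filter (cg 0)).
  apply: near_eq_cvg; near=> s; rewrite fg // in_itv /=; apply/andP; split.
    by near: s; exact: nbhs_right_ge.
  by near: s; exact: nbhs_right_le.
- have [|g [u [/smooth_continuous cg ut fg]]] := @piecewise_smooth_left f 1 pf.
    by rewrite lexx ltr01.
  rewrite fg ?in_itv /= ?lexx ?ltW //.
  apply: cvg_trans (cvg_at_left_filter (cg 1)).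
  apply: near_eq_cvg; near=> s; rewrite fg // in_itv /=; apply/andP; split.
    by near: s; exact: nbhs_left_ge.
  by near: s; exact: nbhs_left_le.
Unshelve. all: by end_near. Qed.

Lemma integrable_disjointU d (T : measurableType d) (m : measure T R)
    (A B : set T) (h : T -> \bar R) :
  measurable A -> measurable B -> [disjoint A & B] ->
  m.-integrable A h -> m.-integrable B h -> m.-integrable (A `|` B) h.
Proof.
move=> mA mB AB /integrableP[mhA iA] /integrableP[mhB iB].
have mh := (measurable_funU _ mA mB).2 (conj mhA mhB).
apply/integrableP; split => //.
rewrite ge0_integral_setU //; first by rewrite lte_add_pinfty.
exact: measurableT_comp.
Qed.

Lemma smooth_speed_integrable f g u v : smooth f -> smooth g ->
  mu.-integrable `[u, v] (EFin \o speed f g).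
Proof.
move=> sf sg; apply: continuous_compact_integrable; first exact: segment_compact.
apply: continuous_subspaceT; exact: smooth_speed_continuous.
Qed.

Lemma eq_in_speed_integrable f g (f0 g0 : R -> R) u v : smooth f0 -> smooth g0 ->
  {in `[u, v], f =1 f0} -> {in `[u, v], g =1 g0} ->
  mu.-integrable `]u, v[ (EFin \o speed f g).
Proof.
move=> sf sg ff gg.
have h : {in `]u, v[%classic, EFin \o speed f0 g0 =1 EFin \o speed f g}.
  move=> t; rewrite inE /= in_itv /= => uv; congr EFin.
  by rewrite (eq_in_speed uv ff gg).
have m : measurable (`]u, v[%classic : set (measurableTypeR R)) by [].
apply: (eq_integrable m _ _ h).
apply: (integrableS _ _ _ (smooth_speed_integrable u v sf sg)) => //.
exact: subset_itv_oo_cc.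
Qed.

Lemma integrable_singleton (h : R -> R) u : mu.-integrable [set u] (EFin \o h).
Proof.
apply/integrableP; split; first exact: measurable_fun_set1.
by rewrite integral_set1.
Qed.

(** Continuous induction avoids a common subdivision for the two coordinates. Break points, where
    the derivative may be a meaningless value, are split off as singletons of measure zero. *)
Lemma speed_integrable f g : piecewise_smooth f -> piecewise_smooth g ->
  mu.-integrable `[0, 1] (EFin \o speed f g).
Proof.
move=> pf pg.
apply: (@real_induction R (fun t => mu.-integrable `[0, t] (EFin \o speed f g)) 0 1).
- exact: ler01.
- by rewrite set_itv1; exact: integrable_singleton.
- move=> t /andP[t0 t1] It.
  have [|f0 [g0 [v [sf sg tv ff gg]]]] := piecewise_smooth2_right (t := t) pf pg.
    by rewrite t0.
  near=> s.
  have ts : t < s by near: s; exact: nbhs_right_gt.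
  have sv : s < v by near: s; exact: nbhs_right_lt.
  have -> : `[0, s]%classic = `[0, t] `|` `]t, s].
    by apply: itv_bndbnd_setU; rewrite bnd_simp // ltW.
  apply: integrable_disjointU => //.
    by apply/disj_set2P; rewrite -subset0 => x /= []; rewrite !in_itv /= => /andP[_ h1] /andP[h2 _]; lra.
  apply: (integrableS _ _ _ (eq_in_speed_integrable sf sg ff gg)) => //.
  by move=> x /=; rewrite !in_itv /= => /andP[-> h]; exact: le_lt_trans sv.
- move=> t /andP[t0 t1] Is.
  have [|f0 [g0 [u [sf sg ut ff gg]]]] := piecewise_smooth2_left (t := t) pf pg.
    by rewrite t0.
  pose w := Num.max 0 u.
  have w0 : 0 <= w by rewrite le_max lexx.
  have wt : w < t by rewrite gt_max t0.
  have uw : u <= w by rewrite le_max lexx orbT.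
  have -> : `[0, t]%classic = `[0, w] `|` (`]w, t[ `|` [set t]).
    rewrite setUitv1 ?bnd_simp //.
    by apply: itv_bndbnd_setU; rewrite bnd_simp // ltW.
  apply: integrable_disjointU => //; first exact: measurableU.
  - apply/disj_set2P; rewrite -subset0 => x /= []; rewrite !in_itv /= => /andP[_ h1].
    by case=> [/andP[h2 _]|xt]; lra.
  - by apply: Is; rewrite w0.
  apply: integrable_disjointU => //; last exact: integrable_singleton.
    apply/disj_set2P; rewrite -subset0 => x /= []; rewrite !in_itv /= => /andP[_ h1] h2; lra.
  apply: (integrableS _ _ _ (eq_in_speed_integrable sf sg ff gg)) => //.
  by move=> x /=; rewrite !in_itv /= => /andP[h ->]; rewrite (le_lt_trans uw).
Unshelve. all: by end_near. Qed.

End Speed.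

(* At each time the increments of [F] are controlled only relatively to that
   time, which suffices to run a continuous induction. *)
Lemma increment_le_length (R : realType) (f g F : R -> R) (C : R) : 0 <= C ->
  piecewise_smooth f -> piecewise_smooth g -> {within `[0, 1], continuous F} ->
  (forall t : R, 0 <= t <= 1 -> \forall s \near t, 0 <= s <= 1 ->
    `|F s - F t| <= C * Num.sqrt ((f s - f t) ^+ 2 + (g s - g t) ^+ 2)) ->
  F 1 - F 0 <= C * \int[lebesgue_measure]_(t in `[0, 1]) speed f g t.
Proof.
move=> C0 pf pg cF FC.
have I01 := speed_integrable pf pg.
have Isub (a b : itv_bound R) : [set` Interval a b] `<=` `[0, 1]%classic ->
    lebesgue_measure.-integrable [set` Interval a b] (EFin \o speed f g).
  by move=> ab; apply: (integrableS _ _ _ I01).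
pose L t := \int[lebesgue_measure]_(t in `[0, t]) speed f g t.
have Ladd s t : 0 <= s -> s <= t -> t <= 1 ->
    L t - L s = \int[lebesgue_measure]_(x in `]s, t]) speed f g x.
  move=> s0 st t1; rewrite /L Rintegral_itvB ?bnd_simp //.
  apply: Isub => x /=; rewrite !in_itv /= => /andP[-> h]; exact: le_trans t1.
have Lmono s t : 0 <= s -> s <= t -> t <= 1 -> L s <= L t.
  move=> s0 st t1; rewrite -subr_ge0 Ladd //.
  by apply: Rintegral_ge0 => x _; exact: speed_ge0.
suff eps e : 0 < e -> F 1 - F 0 <= C * L 1 + e.
  by apply/ler_addgt0Pr => e e0; exact: eps.
move=> e0.
(* The slack grows linearly with time, so every short interval brings its own share [e * (s - t)] to
   absorb the local errors. *)
suff : F 1 - F 0 <= C * L 1 + e * 1 by rewrite mulr1.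
apply: (@real_induction R (fun t => F t - F 0 <= C * L t + e * t) 0 1) => //.
- rewrite subrr mulr0 addr0 mulr_ge0 //.
  by apply: Rintegral_ge0 => x _; exact: speed_ge0.
- move=> t /andP[t0 t1] Ft.
  have [|f0 [g0 [v [sf sg tv ff gg]]]] := piecewise_smooth2_right (t := t) pf pg.
    by rewrite t0.
  (* The chord is overestimated by [2 * d] per unit of time, one [d] for each coordinate, and the
     length is underestimated by [d]; hence the factor 3. The summand 1 keeps the denominator
     positive when [C] is 0. *)
  pose d := e / (3 * C + 1).
  have C1 : 0 < 3 * C + 1 by rewrite ltr_wpDl // mulr_ge0.
  have d0 : 0 < d by rewrite divr_gt0.
  have dC : C * (3 * d) <= e.
    have -> : e = d * (3 * C + 1) by rewrite /d divfK // gt_eqF.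
    by nra.
  have dgf := derivable_near_right (@smooth_derivable R f0 t sf) d0.
  have dgg := derivable_near_right (@smooth_derivable R g0 t sg) d0.
  have cs := smooth_speed_continuous sf sg.
  have [r /= r0 hr] : \forall s \near t, `|speed f0 g0 t - speed f0 g0 s| < d.
    by have /cvgrPdist_lt := cs t; exact.
  have t01 : 0 <= t <= 1 by rewrite t0 ltW.
  near=> s.
  have ts : t < s by near: s; exact: nbhs_right_gt.
  have sv : s < v by near: s; exact: nbhs_right_lt.
  have s1 : s < 1 by near: s; exact: nbhs_right_lt.
  have sr : s < t + r by near: s; apply: nbhs_right_lt; rewrite ltrDl.
  have hf : `|f0 s - f0 t - f0^`()%classic t * (s - t)| <= d * (s - t) by near: s.
  have hg : `|g0 s - g0 t - g0^`()%classic t * (s - t)| <= d * (s - t) by near: s.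
  have hF : `|F s - F t| <= C * Num.sqrt ((f s - f t) ^+ 2 + (g s - g t) ^+ 2).
    have s01 : 0 <= s <= 1 by by apply/andP; split; lra.
    by move: s01; near: s; apply: cvg_within; exact: FC.
  have st0 : 0 < s - t by rewrite subr_gt0.
  have upper : Num.sqrt ((f s - f t) ^+ 2 + (g s - g t) ^+ 2) <=
      (speed f0 g0 t + 2 * d) * (s - t).
    rewrite !ff ?gg ?in_itv /= ?lexx ?(ltW ts) ?(ltW sv) ?(ltW tv) //.
    set a := f0^`()%classic t * (s - t) in hf.
    set b := g0^`()%classic t * (s - t) in hg.
    rewrite -[f0 s - f0 t](subrK a) -[g0 s - g0 t](subrK b).
    rewrite [_ - a + a]addrC [_ - b + b]addrC.
    apply: le_trans (norm2_triangle _ _ _ _) _.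
    have -> : Num.sqrt (a ^+ 2 + b ^+ 2) = speed f0 g0 t * (s - t).
      rewrite /a /b !exprMn -mulrDl sqrtrM ?addr_ge0 ?sqr_ge0 //.
      by rewrite sqrtr_sqr gtr0_norm.
    by lra.
  have lower : (speed f0 g0 t - d) * (s - t) <= L s - L t.
    rewrite Ladd ?(ltW ts) ?(ltW s1) //.
    have -> : (speed f0 g0 t - d) * (s - t) =
        \int[lebesgue_measure]_(x in `]t, s]) (speed f0 g0 t - d).
      rewrite Rintegral_cst //= lebesgue_measure_itv /= lte_fin ts.
      by rewrite -EFinB.
    apply: le_Rintegral => //.
    - have I : lebesgue_measure.-integrable `[t, s]
          (EFin \o fun=> speed f0 g0 t - d).
        apply: continuous_compact_integrable; first exact: segment_compact.
        by apply: continuous_subspaceT; exact: cst_continuous.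
      by apply: (integrableS _ _ _ I) => //; exact: subset_itv_oc_cc.
    - apply: Isub => x /=; rewrite !in_itv /= => /andP[h1 h2]; apply/andP; split; lra.
    - move=> x /=; rewrite in_itv /= => /andP[tx xs].
      rewrite (@eq_in_speed _ f g f0 g0 t v) ?tx ?(le_lt_trans xs) //.
      have : `|speed f0 g0 t - speed f0 g0 x| < d.
        by apply: hr => /=; rewrite ltr0_norm; lra.
      by rewrite ltr_norml => /andP[h1 h2]; lra.
  have : F s - F t <= C * ((speed f0 g0 t + 2 * d) * (s - t)).
    by apply: le_trans (ler_norm _) (le_trans hF _); exact: ler_wpM2l.
  have : C * ((speed f0 g0 t - d) * (s - t)) <= C * (L s - L t) by exact: ler_wpM2l.
  have : C * (3 * d) * (s - t) <= e * (s - t) by rewrite ler_wpM2r // ltW.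
  by lra.
- move=> t /andP[t0 t1] Fs.
  (* Since [F] is continuous at [t] and [L] is nondecreasing, the bound at one earlier time [s]
     passes to [t] up to [r]. *)
  apply/ler_addgt0Pr => r r0.
  have /subspace_continuousP := cF.
  move=> /(_ t); rewrite /= in_itv /= (ltW t0) t1 => /(_ isT) /cvgrPdist_lt /(_ _ r0).
  rewrite near_withinE => Ft.
  have : \forall s \near t^'-, [/\ 0 <= s, s < t & `|F t - F s| < r].
    near=> s.
    have s0 : 0 <= s by near: s; exact: nbhs_left_ge.
    have st : s < t by near: s; exact: nbhs_left_lt.
    split => //.
    have : s \in `[0, 1] by rewrite in_itv /= s0; lra.
    by near: s; apply: cvg_within; exact: Ft.
  move=> /filter_ex[s [s0 st]]; rewrite ltr_norml => /andP[h1 h2].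
  have := Fs s; rewrite s0 st => /(_ isT) h.
  have := Lmono s t s0 (ltW st) t1 => LL.
  have : C * L s <= C * L t by exact: ler_wpM2l.
  have : e * s <= e * t by rewrite ler_wpM2l // ltW.
  by lra.
Unshelve. all: by end_near. Qed.

(** * Windings along closed curves *)

Section Curves.
Variables (R : realType) (n : nat).
Local Notation Lpoly := (Lpoly R n).
Local Notation Lproj := (@Lproj R n).
Local Notation Lsurface := (Lsurface R n).
Local Notation N := (n%:R : R).

(* Circle-valued functions on the surface, up to the addition of integers.  They
   are dual to the edges [0,1] x 0, 0 x [1,n+1], [1,n+1] x 0 and 0 x [0,1]. *)
Definition angle (i : 'I_4) (p : R * R) : R :=
  match val i with
  | 0%N => Num.min p.1 1
  | 1%N => Num.max (p.2 - 1) 0 / N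
  | 2%N => Num.max (p.1 - 1) 0 / N
  | _ => Num.min p.2 1
  end.

Lemma angle_glue i : glue_invariant n (angle i).
Proof.
have N1 : n.+1%:R = N + 1 :> R by rewrite -natr1.
have N0 : 0 <= N by rewrite ler0n.
have Nn : N / N \is a Num.int.
  by have [->|n0] := eqVneq N 0; rewrite ?mul0r ?rpred0 // divff // rpred1.
have m0 : Num.min 0 1 = 0 :> R by rewrite min_l.
have m1 : Num.min (N + 1) 1 = 1 :> R by rewrite min_r // lerDr.
have m2 : Num.max (0 - 1) 0 = 0 :> R by rewrite max_r // sub0r oppr_le0.
have m3 : Num.max (N + 1 - 1) 0 = N :> R by rewrite addrK max_l.
have m4 : Num.max (1 - 1) 0 = 0 :> R by rewrite subrr maxxx.
by case: i => -[|[|[|[|//]]]] ? p q [t [] [_ [-> ->]]];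
  rewrite /angle /= ?N1 ?m0 ?m1 ?m2 ?m3 ?m4 ?minxx ?mul0r ?subrr ?sub0r ?rpredN
    ?rpred0 ?rpred1.
Qed.

Lemma angle_lipschitz i (p q : R * R) :
  `|angle i p - angle i q| <= `|p.1 - q.1| + `|p.2 - q.2|.
Proof.
have ml (x y : R) : `|Num.min x 1 - Num.min y 1| <= `|x - y|.
  rewrite /Num.min; case: ifPn; case: ifPn; rewrite -?leNgt => h1 h2 //.
  - by rewrite ler0_norm ?ler0_norm; lra.
  - by rewrite ger0_norm ?ger0_norm; lra.
  - by rewrite subrr normr0.
have mx (x y : R) : `|Num.max (x - 1) 0 / N - Num.max (y - 1) 0 / N| <= `|x - y|.
  rewrite -mulrBl normrM.
  have [->|n0] := eqVneq N 0; first by rewrite invr0 normr0 mulr0.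
  have N1 : `|N^-1| <= 1.
    rewrite ger0_norm ?invr_ge0 ?ler0n // invf_le1 ?ler1n ?ltr0n lt0n;
    by move: n0; rewrite pnatr_eq0.
  apply: (@le_trans _ _ (`|Num.max (x - 1) 0 - Num.max (y - 1) 0| * 1)).
    exact: ler_wpM2l.
  rewrite mulr1 /Num.max; case: ifPn; case: ifPn; rewrite -?leNgt => h1 h2.
  - by rewrite subrr normr0.
  - by rewrite ler0_norm ?ler0_norm; lra.
  - by rewrite ger0_norm ?ger0_norm; lra.
  - by rewrite (_ : x - 1 - (y - 1) = x - y); lra.
case: i => -[|[|[|[|//]]]] ?; rewrite /angle /=.
- by apply: le_trans (ml _ _) _; rewrite lerDl.
- by apply: le_trans (mx _ _) _; rewrite lerDr.
- by apply: le_trans (mx _ _) _; rewrite lerDl.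
- by apply: le_trans (ml _ _) _; rewrite lerDr.
Qed.

Definition angle_cochain i : cochain R Lsurface 1 :=
  winding (fun x : Lsurface => angle i (val (repr x))).

Lemma angle_cochain_cocycle i : cocycle (angle_cochain i).
Proof.
apply: winding_cocycle; apply: glue_mod1_continuous.
  exact: angle_glue.
exact: angle_lipschitz.
Qed.

(** The combination with coefficients [c] has the constant gradients (c0, c3) on the corner square,
    (c0, c1/n) on the upper arm and (c2/n, c3) on the right arm. *)
Definition comass (c : 'I_4 -> R) (C : R) :=
  [/\ c 0 ^+ 2 + c 3 ^+ 2 <= C ^+ 2,
      c 0 ^+ 2 + (c 1 / N) ^+ 2 <= C ^+ 2
    & (c 2 / N) ^+ 2 + c 3 ^+ 2 <= C ^+ 2].

(** On a single piece the minima and maxima are resolved in the same way at both points, so the sum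
    is the scalar product of a constant gradient with the displacement. *)
Lemma angle_combination (c : 'I_4 -> R) C p q : 0 <= C -> comass c C ->
  same_piece p q ->
  `|\sum_i c i * (angle i p - angle i q)| <=
    C * Num.sqrt ((p.1 - q.1) ^+ 2 + (p.2 - q.2) ^+ 2).
Proof.
move=> C0 [h1 h2 h3] pq.
rewrite !big_ord_recl big_ord0 addr0.
have -> : lift ord0 (ord0 : 'I_3) = 1 by exact/val_inj.
have -> : lift ord0 (lift ord0 (ord0 : 'I_2)) = 2 by exact/val_inj.
have -> : lift ord0 (lift ord0 (lift ord0 (ord0 : 'I_1))) = 3 by exact/val_inj.
have -> : (ord0 : 'I_4) = 0 by exact/val_inj.
rewrite /angle /=.
case: pq => -[a1 a2 a3 a4].
- rewrite !min_l // !max_r ?subr_le0 // mul0r !subrr !mulr0 !add0r.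
  exact: norm2_cauchy.
- rewrite !(min_l a1) !(min_l a3) (@max_r _ _ (p.1 - 1)) ?subr_le0 //.
  rewrite (@max_r _ _ (q.1 - 1)) ?subr_le0 // !max_l ?subr_ge0 // !min_r // mul0r !subrr !mulr0 !addr0.
  rewrite [X in _ + X](_ : _ = c 1 / N * (p.2 - q.2)); last by ring.
  exact: norm2_cauchy.
- rewrite !(min_l a2) !(min_l a4) (@max_r _ _ (p.2 - 1)) ?subr_le0 //.
  rewrite (@max_r _ _ (q.2 - 1)) ?subr_le0 // !max_l ?subr_ge0 // !min_r // mul0r !subrr !mulr0 !add0r.
  rewrite [X in X + _](_ : _ = c 2 / N * (p.1 - q.1)); last by ring.
  exact: norm2_cauchy.
Qed.

End Curves.

Lemma path_winding (R : realType) (X : topologicalType) (h : X -> R) (g : R -> X)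
    (cg : {within `[0, 1], continuous g}) : mod1_continuous h ->
  exists F : R -> R, [/\ {within `[0, 1], continuous F},
    forall t, 0 <= t <= 1 -> F t - h (g t) \is a Num.int
    & winding h (path_simplex cg) = F 1 - F 0].
Proof.
move=> ch.
have [H cH Hs] := mod1_simplex_lift (mod1_continuous_simplex ch (path_simplex cg)).
pose seg (t : R) : std_simplex R 1 := segm (vertex R 0) (vertex R 1) t.
have cseg : continuous seg.
  move=> t; exact: (@continuous_comp _ _ _ (fun t : R => (t, vertex R 1)) _ t
    (cvg_pair cvg_id (cvg_cst _)) (@segm_continuous R 1 _ (t, vertex R 1))).
exists (H \o seg); split.
- apply: continuous_subspaceT => t.
  by apply: continuous_comp; [exact: cseg | exact: cH].
- move=> t t01; have := Hs (seg t).
  have e : (val (seg t) : 'rV[R]_2) 0 1 = t.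
    by rewrite /= !mxE /= clamp_id // mulr0 add0r mulr1.
  by rewrite /= (congr1 g e : path_simplex cg (seg t) = g t).
- by rewrite (windingE cH Hs) /= /seg segm0 segm1.
Qed.

(** * Calibration: windings bounded by length *)

Section Calibration.
Variables (R : realType) (n : nat).
Local Notation Lpoly := (Lpoly R n).
Local Notation Lproj := (@Lproj R n).

(** The displacement in the polygon and that of the development agree modulo integers and are both
    less than 1/4 in each coordinate, hence are equal. The representative [p0] of the base point may
    depend on [t], which is why two times other than [t0] are not compared directly. *)
Lemma curve_near (al : closed_curve R n) (t0 : R) : 0 <= t0 <= 1 ->
  \forall t \near t0, 0 <= t <= 1 -> exists p p0 : Lpoly,
    [/\ Lproj p = curve al t, Lproj p0 = curve al t0, close 4^-1 (val p) (val p0),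
        same_piece (val p) (val p0)
      & (val p).1 - (val p0).1 = dev_x al t - dev_x al t0 /\
        (val p).2 - (val p0).2 = dev_y al t - dev_y al t0].
Proof.
move=> t01.
have t0in : `[0, 1]%classic t0 by rewrite /= in_itv.
have i4 : (0 : R) < 4^-1 by rewrite invr_gt0.
have /subspace_continuousP/(_ _ t0in) cc := @curve_continuous _ _ al.
have := cc _ (near_same_piece (curve al t0) i4).
have /subspace_continuousP/(_ _ t0in)/cvgrPdist_lt/(_ _ i4) :=
  piecewise_smooth_continuous (dev_x_smooth al).
have /subspace_continuousP/(_ _ t0in)/cvgrPdist_lt/(_ _ i4) :=
  piecewise_smooth_continuous (dev_y_smooth al).
rewrite /= !near_withinE => ny nx /= np; near=> t => t1.
have tin : `[0, 1]%classic t by rewrite /= in_itv.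
have yt : `|dev_y al t0 - dev_y al t| < 4^-1 by move: tin; near: t.
have xt : `|dev_x al t0 - dev_x al t| < 4^-1 by move: tin; near: t.
have [p [p0 [pt pt0 cl sp]]] : exists p p0 : Lpoly,
  [/\ Lproj p = curve al t, Lproj p0 = curve al t0, close 4^-1 (val p) (val p0)
    & same_piece (val p) (val p0)] by move: tin; near: t; exact: np.
exists p, p0; split => //.
have [q [a [b [qt qa qb]]]] := @curve_dev _ _ al t t1.
have [q0 [a0 [b0 [qt0 qa0 qb0]]]] := @curve_dev _ _ al t0 t01.
have eqp : Lproj p = Lproj q by rewrite pt.
have eqp0 : Lproj p0 = Lproj q0 by rewrite pt0.
case: cl => cl1 cl2.
have shift_eq (x y z w c d : R) (k l : int) :
    x - z \is a Num.int -> y - w \is a Num.int ->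
    `|x - y| < 4^-1 -> `|d - c| < 4^-1 -> c = z + k%:~R -> d = w + l%:~R ->
    x - y = c - d.
  move=> xz yw xy cd ce de; apply/eqP; rewrite -subr_eq0; apply/eqP/int_norm_lt1.
    rewrite (_ : _ - _ = (x - z) - (y - w) - (k%:~R - l%:~R)); last by lra.
    by apply: rpredB; apply: rpredB => //; exact: intr_int.
  by apply: (le_lt_trans (ler_normB _ _)); rewrite [`|c - d|]distrC; lra.
split.
- apply: shift_eq qa qa0 => //; apply: Lproj_invariant => //; exact: glue_invariant_fst.
- apply: shift_eq qb qb0 => //; apply: Lproj_invariant => //; exact: glue_invariant_snd.
Unshelve. all: by end_near. Qed.

Definition period (al : closed_curve R n) (i : 'I_4) : R :=
  pairing (angle_cochain i) (curve_chain al).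

(** The real lifts of the four functions along the curve combine into one function whose total
    increment is the left side. Near each time its increments are those of the combination between
    two points of one piece, so [increment_le_length] applies. *)
Lemma period_le_length (al : closed_curve R n) (c : 'I_4 -> R) (C : R) :
  0 <= C -> comass n c C -> \sum_i c i * period al i <= C * length al.
Proof.
move=> C0 cC.
have /choice[F HF] : forall i, exists F : R -> R,
  [/\ {within `[0, 1], continuous F},
    forall t, 0 <= t <= 1 -> F t - angle n i (val (repr (curve al t))) \is a Num.int
    & period al i = F 1 - F 0].
  move=> i; have [|F [cF iF wF]] := @path_winding R _
    (fun x : Lsurface R n => angle n i (val (repr x))) _ (@curve_continuous _ _ al).
    by apply: glue_mod1_continuous; [exact: angle_glue | exact: angle_lipschitz].
  by exists F; split => //; rewrite /period /curve_chain pairingU.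
pose G t := \sum_i c i * F i t.
have -> : \sum_i c i * period al i = G 1 - G 0.
  rewrite /G -sumrB; apply: eq_bigr => i _.
  by have [_ _ ->] := HF i; rewrite mulrBr.
apply: increment_le_length => //.
- exact: dev_x_smooth.
- exact: dev_y_smooth.
- move=> t; apply: continuous_big => [|i _]; first exact: add_continuous.
  by move=> x; apply: cvgM; [exact: cvg_cst | have [cF _ _] := HF i; exact: cF].
move=> t0 t01.
have t0in : `[0, 1]%classic t0 by rewrite /= in_itv.
(* This 1/2 and the two 1/4 from [close], through the Lipschitz bound, keep an integral difference
   of increments below 1, so that it vanishes. *)
have nF : \forall t \near t0, 0 <= t <= 1 -> forall i, `|F i t0 - F i t| < 2^-1.
  have i2 : (0 : R) < 2^-1 by rewrite invr_gt0.
  have h i : \forall t \near t0, 0 <= t <= 1 -> `|F i t0 - F i t| < 2^-1.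
    have [/subspace_continuousP/(_ _ t0in)/cvgrPdist_lt/(_ _ i2) + _ _] := HF i.
    rewrite near_withinE; apply: filterS => t ht t1; apply: ht.
    by rewrite /= in_itv.
  have H := @filter_forall R 'I_4 (fun i t => 0 <= t <= 1 ->
    `|F i t0 - F i t| < 2^-1) (nbhs t0) (nbhs_filter t0) h.
  by apply: (filterS _ H) => t ht t1 i; exact: ht.
near=> t => t1.
have [p [p0 [pt pt0 [cl1 cl2] sp [dx dy]]]] : exists p p0 : Lpoly,
    [/\ Lproj p = curve al t, Lproj p0 = curve al t0, close 4^-1 (val p) (val p0),
        same_piece (val p) (val p0)
      & (val p).1 - (val p0).1 = dev_x al t - dev_x al t0 /\
        (val p).2 - (val p0).2 = dev_y al t - dev_y al t0].
  by move: t1; near: t; exact: curve_near.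
rewrite -dx -dy.
have -> : G t - G t0 = \sum_i c i * (angle n i (val p) - angle n i (val p0)).
  rewrite /G -sumrB; apply: eq_bigr => i _; rewrite -mulrBr; congr (_ * _).
  have [_ iF _] := HF i.
  have Ft : `|F i t0 - F i t| < 2^-1.
    by move: i {iF}; move: t1; near: t; exact: nF.
  apply/eqP; rewrite -subr_eq0; apply/eqP/int_norm_lt1.
    rewrite (_ : _ - _ = (F i t - angle n i (val (repr (curve al t)))) -
     (F i t0 - angle n i (val (repr (curve al t0)))) -
     ((angle n i (val p) - angle n i (val (repr (curve al t)))) -
      (angle n i (val p0) - angle n i (val (repr (curve al t0))))));
      last by lra.
    apply: rpredB; first by apply: rpredB; exact: iF.
    by apply: rpredB; apply: Lproj_invariant; rewrite ?Lproj_repr //; exact: angle_glue.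
  have := angle_lipschitz n i (val p) (val p0).
  have := ler_normB (F i t - F i t0) (angle n i (val p) - angle n i (val p0)).
  by rewrite [`|F i t - _|]distrC; lra.
exact: angle_combination.
Unshelve. all: by end_near. Qed.

End Calibration.

(** * Edges of the triangulation *)

Lemma singular_simplex_eq (R : realType) (X : topologicalType) k
    (s t : singular_simplex R X k) : (forall v, s v = t v) -> s = t.
Proof. by move=> st; exact/continuousEP. Qed.

Lemma std_simplex1E (R : realType) (v : std_simplex R 1) :
  (val v : 'rV[R]_2) 0 0 = 1 - (val v : 'rV[R]_2) 0 1.
Proof.
have [_] := set_valP v; rewrite big_ord_recl big_ord1.
have -> : lift ord0 ord0 = 1 :> 'I_2 by exact/val_inj.
by rewrite /= => <-; rewrite addrK.
Qed.

Section Rectangles.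
Variables (R : realType) (n : nat).
Local Notation Lpoly := (Lpoly R n).
Local Notation Lproj := (@Lproj R n).
Local Notation Lsurface := (Lsurface R n).
Local Notation edge := (singular_simplex R Lsurface 1).

Lemma affine_vertex (p : 3.-tuple (R * R)) (i : 'I_3) :
  affine p (val (vertex R i)) = tnth p i.
Proof.
have h (z : 'I_3 -> R) : \sum_j (val (vertex R i) : 'rV[R]_3) 0 j * z j = z i.
  rewrite (bigD1 i) //= !mxE eqxx mul1r big1 ?addr0 // => j /negbTE ji.
  by rewrite !mxE ji mul0r.
by rewrite /affine !h; case: (tnth p i).
Qed.

Lemma affine_face (p : 3.-tuple (R * R)) (i : 'I_3) (v : std_simplex R 1) :
  let t := (val v : 'rV[R]_2) 0 1 in
  let a := tnth p (lift i 0) in let b := tnth p (lift i 1) in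
  affine p (val (face_map i v)) =
  ((1 - t) * a.1 + t * b.1, (1 - t) * a.2 + t * b.2).
Proof.
move=> t a b.
have h (z : 'I_3 -> R) : \sum_j (val (face_map i v) : 'rV[R]_3) 0 j * z j =
    (1 - t) * z (lift i 0) + t * z (lift i 1).
  rewrite (bigD1_ord i) //= mxE unlift_none mul0r add0r.
  rewrite big_ord_recl big_ord1 !mxE.
  have -> : lift ord0 ord0 = 1 :> 'I_2 by exact/val_inj.
  by rewrite !liftK std_simplex1E.
by rewrite /affine !h.
Qed.

Section Edges.
Variables (a b c d : R) (ab : a <= b) (cd : c <= d).
Variable sub : box a b c d `<=` Lpoly.
Let lower := triangle sub (lower_tri_box ab cd).
Let upper := triangle sub (upper_tri_box ab cd).

Definition bottom : edge := face ord_max lower.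
Definition right : edge := face 0 lower.
Definition left : edge := face ord_max upper.
Definition top : edge := face 0 upper.

Lemma face_triangle (p : 3.-tuple (R * R)) (hp : forall i, box a b c d (tnth p i))
    (i : 'I_3) (v : std_simplex R 1) :
  let t := (val v : 'rV[R]_2) 0 1 in
  let a := tnth p (lift i 0) in let b := tnth p (lift i 1) in
  exists2 q : Lpoly, face i (triangle sub hp) v = Lproj q
    & val q = ((1 - t) * a.1 + t * b.1, (1 - t) * a.2 + t * b.2).
Proof.
move=> t a' b'; exists (triangle_point sub hp (face_map i v)) => //.
exact: affine_face.
Qed.

Lemma bottomE v : let t := (val v : 'rV[R]_2) 0 1 in
  exists2 q : Lpoly, bottom v = Lproj q & val q = ((1 - t) * a + t * b, c).
Proof.
have [q e vq] := face_triangle (lower_tri_box ab cd) ord_max v.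
exists q => //; rewrite vq !(tnth_nth 0) /=; congr (_, _); lra.
Qed.

Lemma rightE v : let t := (val v : 'rV[R]_2) 0 1 in
  exists2 q : Lpoly, right v = Lproj q & val q = (b, (1 - t) * c + t * d).
Proof.
have [q e vq] := face_triangle (lower_tri_box ab cd) 0 v.
exists q => //; rewrite vq !(tnth_nth 0) /=; congr (_, _); lra.
Qed.

Lemma leftE v : let t := (val v : 'rV[R]_2) 0 1 in
  exists2 q : Lpoly, left v = Lproj q & val q = (a, (1 - t) * c + t * d).
Proof.
have [q e vq] := face_triangle (upper_tri_box ab cd) ord_max v.
exists q => //; rewrite vq !(tnth_nth 0) /=; congr (_, _); lra.
Qed.

Lemma topE v : let t := (val v : 'rV[R]_2) 0 1 in
  exists2 q : Lpoly, top v = Lproj q & val q = ((1 - t) * a + t * b, d).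
Proof.
have [q e vq] := face_triangle (upper_tri_box ab cd) 0 v.
exists q => //; rewrite vq !(tnth_nth 0) /=; congr (_, _); lra.
Qed.

Lemma diagonal_eq : face 1 lower = face 1 upper.
Proof.
apply: singular_simplex_eq => v; congr (Lproj _); apply: val_inj => /=.
by rewrite !affine_face !(tnth_nth 0).
Qed.

Lemma boundary_rect : boundary (rect_chain ab cd sub) =
  << bottom >> + << right >> - << left >> - << top >> :> chain R Lsurface 1.
Proof.
rewrite /rect_chain raddfB /= !boundary2U -diagonal_eq.
rewrite -[right]/(face 0 _) -[bottom]/(face ord_max _).
rewrite -[left]/(face ord_max _) -[top]/(face 0 _).
rewrite [X in X - _]addrC addrA [X in _ - X]addrAC opprB addrA subrK.
by rewrite opprD addrA addrAC.
Qed.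

Lemma cocycle_rect (phi : cochain R Lsurface 1) : cocycle phi ->
  phi bottom + phi right = phi left + phi top.
Proof.
by move=> /cocycleP ph; rewrite /bottom /right /left /top -!ph diagonal_eq.
Qed.

Lemma pairing_cup_rect (phi psi : cochain R Lsurface 1) :
  pairing (cup phi psi) (rect_chain ab cd sub) =
  phi bottom * psi right - phi left * psi top.
Proof. by rewrite /rect_chain raddfB /= !pairingU. Qed.

Lemma cap_rect (phi : cochain R Lsurface 1) :
  cap (rect_chain ab cd sub) phi =
  phi bottom *: << right >> - phi left *: << top >>.
Proof. by rewrite /cap /rect_chain raddfB /= !fgliftU. Qed.

Lemma angle_continuous i : continuous (angle n i : R * R -> R).
Proof.
move=> p; apply/cvgrPdist_lt => e e0.
have e2 : 0 < e / 2 by rewrite divr_gt0.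
have /cvgrPdist_lt/(_ _ e2) h1 : fst q @[q --> p] --> p.1 by exact: cvg_fst.
have /cvgrPdist_lt/(_ _ e2) h2 : snd q @[q --> p] --> p.2 by exact: cvg_snd.
near=> q; apply: le_lt_trans (angle_lipschitz n i p q) _.
rewrite [ltRHS]splitr; apply: ltrD; near: q; [exact: h1 | exact: h2].
Unshelve. all: by end_near. Qed.

(** Before gluing, [angle n i] is a continuous real function on the plane, so along a straight edge
    it is its own lift. *)
Lemma angle_cochain_face i (p : 3.-tuple (R * R))
    (hp : forall i, box a b c d (tnth p i)) (j : 'I_3) :
  angle_cochain i (face j (triangle sub hp)) =
  angle n i (tnth p (lift j 1)) - angle n i (tnth p (lift j 0)).
Proof.
pose H v := angle n i (affine p (val (face_map j v))).
have HE k : angle n i (tnth p (lift j k)) = H (vertex R k).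
  by rewrite /H face_map_vertex affine_vertex.
rewrite !HE; apply: windingE => v.
  apply: (@continuous_comp _ _ _ (fun v : std_simplex R 1 => affine p (val (face_map j v)))
    (angle n i)); last exact: angle_continuous.
  rewrite /affine.
  have cc (z : 'I_3 -> R) :
      continuous (fun w : std_simplex R 2 => \sum_i (val w : 'rV[R]_3) 0 i * z i).
    apply: continuous_big => [|l _ w]; first exact: add_continuous.
    exact: (cvgM (@entry_continuous R 2 l w) (cvg_cst (z l))).
  apply: (@continuous_comp _ _ _ (face_map j)
    (fun w : std_simplex R 2 => affine p (val w))).
    exact: face_map_continuous.
  exact: (cvg_pair (cc (fun i => (tnth p i).1) _) (cc (fun i => (tnth p i).2) _)).
have := @Lproj_invariant R n (angle n i) (triangle_point sub hp (face_map j v))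
  (repr (Lproj (triangle_point sub hp (face_map j v)))).
apply; first exact: angle_glue.
by rewrite Lproj_repr.
Qed.

Lemma angle_bottom i : angle_cochain i bottom = angle n i (b, c) - angle n i (a, c).
Proof. by rewrite angle_cochain_face !(tnth_nth 0). Qed.

Lemma angle_left i : angle_cochain i left = angle n i (a, d) - angle n i (a, c).
Proof. by rewrite angle_cochain_face !(tnth_nth 0). Qed.

End Edges.
End Rectangles.

(** * The intersection form *)

Section Intersection.
Variables (R : realType) (n : nat).
Local Notation Lpoly := (Lpoly R n).
Local Notation Lproj := (@Lproj R n).
Local Notation Lsurface := (Lsurface R n).
Local Notation edge := (singular_simplex R Lsurface 1).
Local Notation N := (n%:R : R).
Local Notation m := (fundamental_cycle R n).
Local Notation le01 := (@ler01 R).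
Local Notation le1n := (@le1n R n).

Definition corner_bottom : edge := bottom le01 le01 (@sub_corner R n).
Definition corner_left : edge := left le01 le01 (@sub_corner R n).
Definition up_left : edge := left le01 le1n (@sub_up R n).
Definition right_bottom : edge := bottom le1n le01 (@sub_right R n).
Let corner_right : edge := right le01 le01 (@sub_corner R n).
Let corner_top : edge := top le01 le01 (@sub_corner R n).
Let up_bottom : edge := bottom le01 le1n (@sub_up R n).
Let up_right : edge := right le01 le1n (@sub_up R n).
Let up_top : edge := top le01 le1n (@sub_up R n).
Let right_left : edge := left le1n le01 (@sub_right R n).
Let right_right : edge := right le1n le01 (@sub_right R n).
Let right_top : edge := top le1n le01 (@sub_right R n).

Lemma Lproj_glued (p q : Lpoly) : glued n (val p) (val q) -> Lproj p = Lproj q.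
Proof. by move=> pq; apply/LprojP; exact: rst_step. Qed.

Lemma convex_itv (a b t : R) : a <= b -> 0 <= t <= 1 ->
  a <= (1 - t) * a + t * b <= b.
Proof. by move=> ab /andP[t0 t1]; apply/andP; split; nra. Qed.

Lemma simplex1_itv (v : std_simplex R 1) : 0 <= (val v : 'rV[R]_2) 0 1 <= 1.
Proof. by have := path_simplex_subproof v; rewrite /= in_itv. Qed.

Lemma up_top_glued : up_top = corner_bottom.
Proof.
apply: singular_simplex_eq => v; have t01 := simplex1_itv v.
have [p -> pe] := topE le01 le1n (@sub_up R n) v.
have [q -> qe] := bottomE le01 le01 (@sub_corner R n) v.
symmetry; apply: Lproj_glued; rewrite pe qe.
by eexists; constructor 1; split; [exact: (convex_itv le01 t01) | split].
Qed.

Lemma corner_top_glued : corner_top = up_bottom.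
Proof.
apply: singular_simplex_eq => v.
have [p -> pe] := topE le01 le01 (@sub_corner R n) v.
have [q -> qe] := bottomE le01 le1n (@sub_up R n) v.
by congr (Lproj _); apply: val_inj; rewrite pe qe.
Qed.

Lemma up_right_glued : up_right = up_left.
Proof.
apply: singular_simplex_eq => v; have t01 := simplex1_itv v.
have [p -> pe] := rightE le01 le1n (@sub_up R n) v.
have [q -> qe] := leftE le01 le1n (@sub_up R n) v.
symmetry; apply: Lproj_glued; rewrite pe qe.
by eexists; constructor 4; split; [exact: (convex_itv le1n t01) | split].
Qed.

Lemma right_top_glued : right_top = right_bottom.
Proof.
apply: singular_simplex_eq => v; have t01 := simplex1_itv v.
have [p -> pe] := topE le1n le01 (@sub_right R n) v.
have [q -> qe] := bottomE le1n le01 (@sub_right R n) v.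
symmetry; apply: Lproj_glued; rewrite pe qe.
by eexists; constructor 2; split; [exact: (convex_itv le1n t01) | split].
Qed.

Lemma right_right_glued : right_right = corner_left.
Proof.
apply: singular_simplex_eq => v; have t01 := simplex1_itv v.
have [p -> pe] := rightE le1n le01 (@sub_right R n) v.
have [q -> qe] := leftE le01 le01 (@sub_corner R n) v.
symmetry; apply: Lproj_glued; rewrite pe qe.
by eexists; constructor 3; split; [exact: (convex_itv le01 t01) | split].
Qed.

Lemma right_left_glued : right_left = corner_right.
Proof.
apply: singular_simplex_eq => v.
have [p -> pe] := leftE le1n le01 (@sub_right R n) v.
have [q -> qe] := rightE le01 le01 (@sub_corner R n) v.
by congr (Lproj _); apply: val_inj; rewrite pe qe.
Qed.

(** The two long sides of an arm are glued to each other, so on that arm the cocycle relation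
    equates the values on the two short sides. Everything is thereby expressed on four edges. *)
Lemma pairing_cup_fundamental (phi psi : cochain R Lsurface 1) :
  cocycle phi -> cocycle psi ->
  pairing (cup phi psi) m =
  (phi corner_bottom * psi corner_left - phi corner_left * psi corner_bottom) +
  (phi corner_bottom * psi up_left - phi up_left * psi corner_bottom) +
  (phi right_bottom * psi corner_left - phi corner_left * psi right_bottom).
Proof.
move=> cphi cpsi.
have Hu (ph : cochain R Lsurface 1) : cocycle ph ->
    ph up_bottom = ph corner_bottom.
  move=> /(cocycle_rect le01 le1n (@sub_up R n)).
  rewrite -/up_bottom -/up_right -/up_left -/up_top up_right_glued up_top_glued.
  lra.
have Hr (ph : cochain R Lsurface 1) : cocycle ph ->
    ph corner_right = ph corner_left.
  move=> /(cocycle_rect le1n le01 (@sub_right R n)).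
  rewrite -/right_bottom -/right_right -/right_left -/right_top.
  rewrite right_top_glued right_right_glued right_left_glued.
  lra.
rewrite /fundamental_cycle 2!raddfD /= !pairing_cup_rect.
rewrite -/corner_bottom -/corner_right -/corner_left -/corner_top.
rewrite -/up_bottom -/up_right -/up_left -/up_top.
rewrite -/right_bottom -/right_right -/right_left -/right_top.
rewrite right_top_glued right_right_glued right_left_glued.
rewrite up_right_glued up_top_glued corner_top_glued.
by rewrite !Hu // !Hr.
Qed.

(** This is an equality of chains: the values of [phi] are simplified, but [corner_right] and
    [up_bottom] stay as edges, being only homologous to [corner_left] and [corner_bottom]. *)
Lemma cap_fundamental (phi : cochain R Lsurface 1) : cocycle phi ->
  cap m phi =
  (phi corner_bottom *: << corner_right >> - phi corner_left *: << up_bottom >>) +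
  (phi corner_bottom *: << up_left >> - phi up_left *: << corner_bottom >>) +
  (phi right_bottom *: << corner_left >> - phi corner_left *: << right_bottom >>).
Proof.
move=> cphi.
have Hu : phi up_bottom = phi corner_bottom.
  have := cocycle_rect le01 le1n (@sub_up R n) cphi.
  rewrite -/up_bottom -/up_right -/up_left -/up_top up_right_glued up_top_glued.
  lra.
have Hr : phi corner_right = phi corner_left.
  have := cocycle_rect le1n le01 (@sub_right R n) cphi.
  rewrite -/right_bottom -/right_right -/right_left -/right_top.
  rewrite right_top_glued right_right_glued right_left_glued.
  lra.
rewrite /fundamental_cycle /cap 2!raddfD /= -!/(cap _ phi) !cap_rect.
rewrite -/corner_bottom -/corner_right -/corner_left -/corner_top.
rewrite -/up_bottom -/up_right -/up_left -/up_top.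
rewrite -/right_bottom -/right_right -/right_left -/right_top.
rewrite right_top_glued right_right_glued right_left_glued.
by rewrite up_right_glued up_top_glued corner_top_glued Hu Hr.
Qed.

Hypothesis n0 : (0 < n)%N.

Lemma angle_edges i :
  [/\ angle_cochain i corner_bottom = (val i == 0)%:R,
      angle_cochain i up_left = (val i == 1)%:R,
      angle_cochain i right_bottom = (val i == 2)%:R
    & angle_cochain i corner_left = (val i == 3)%:R].
Proof.
have N0 : N != 0 by rewrite pnatr_eq0 -lt0n.
have N1 : n.+1%:R = N + 1 :> R by rewrite -natr1.
have m0 : Num.min 0 1 = 0 :> R by rewrite min_l.
have m1 : Num.min (N + 1) 1 = 1 :> R by rewrite min_r // lerDr.
have m2 : Num.max (0 - 1) 0 = 0 :> R by rewrite max_r // sub0r oppr_le0.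
have m3 : Num.max (N + 1 - 1) 0 = N :> R by rewrite addrK max_l.
have m4 : Num.max (1 - 1) 0 = 0 :> R by rewrite subrr maxxx.
rewrite !angle_bottom !angle_left /angle !N1.
by case: i => -[|[|[|[|//]]]] ? /=;
  rewrite ?m0 ?m1 ?m2 ?m3 ?m4 ?minxx ?mul0r ?subrr ?subr0 ?divff.
Qed.

Section Periods.
Variables (phi : cochain R Lsurface 1) (z : chain R Lsurface 1).
Hypotheses (cphi : cocycle phi) (phiz : homologous (cap m phi) z).
Let period i : R := pairing (angle_cochain i) z.

(** Each period of [z] is the cup product of [phi] with one [angle_cochain i]. As these cochains
    form the dual basis on the four edges, this is a triangular linear system in the values of
    [phi]. *)
Lemma poincare_dual_values :
  [/\ phi corner_bottom = period 1, phi corner_left = - period 2,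
      phi up_left = period 2 - period 0 & phi right_bottom = period 3 - period 1].
Proof.
have E i : period i = pairing (cup phi (angle_cochain i)) m.
  rewrite -pairing_cap /period; symmetry.
  by apply: pairing_homologous phiz; exact: angle_cochain_cocycle.
have {}E i : period i =
    (phi corner_bottom * (val i == 3)%:R - phi corner_left * (val i == 0)%:R) +
    (phi corner_bottom * (val i == 1)%:R - phi up_left * (val i == 0)%:R) +
    (phi right_bottom * (val i == 3)%:R - phi corner_left * (val i == 2)%:R).
  rewrite E pairing_cup_fundamental //; last exact: angle_cochain_cocycle.
  by have [-> -> -> ->] := angle_edges i.
by rewrite !E /=; split; lra.
Qed.

End Periods.

(** The hypothesis is membership in the set that [intersection] chooses from; the set thus has at
    most one element, whatever dual cocycles are taken. *)
Lemma intersection_periods (z w : chain R Lsurface 1) (x : R) :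
  (exists phi psi : cochain R Lsurface 1,
    [/\ cocycle phi /\ cocycle psi, homologous (cap m phi) z,
        homologous (cap m psi) w & x = pairing (cup phi psi) m]) ->
  let a i := pairing (angle_cochain i) z in
  let b i := pairing (angle_cochain i) w in
  x = a 0 * b 1 + a 1 * (b 2 - b 0) + a 2 * (b 3 - b 1) - a 3 * b 2.
Proof.
move=> [phi [psi [[cphi cpsi] phiz psiw ->]]] a b.
rewrite pairing_cup_fundamental //.
have [-> -> -> ->] := poincare_dual_values cphi phiz.
have [-> -> -> ->] := poincare_dual_values cpsi psiw.
by rewrite -/(a _) -/(b _); ring.
Qed.

(** * Intersection numbers bounded by lengths *)

Lemma length_ge0 (al : closed_curve R n) : 0 <= length al.
Proof. by apply: Rintegral_ge0 => t _; exact: sqrtr_ge0. Qed.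

(** A vector is tested against itself: taking for [C] its own norm gives [C * C <= C * length al],
    and [C] cancels unless it is 0. *)
Lemma sqr_le_of_period (al : closed_curve R n) (x y : R) :
  (forall C, 0 <= C -> x ^+ 2 + y ^+ 2 <= C ^+ 2 ->
     x * x + y * y <= C * length al) ->
  x ^+ 2 + y ^+ 2 <= length al ^+ 2.
Proof.
move=> H; have xy : 0 <= x ^+ 2 + y ^+ 2 by rewrite addr_ge0 ?sqr_ge0.
pose C := Num.sqrt (x ^+ 2 + y ^+ 2).
have C0 : 0 <= C by exact: sqrtr_ge0.
have CC : C ^+ 2 = x ^+ 2 + y ^+ 2 by rewrite sqr_sqrtr.
have h : C * C <= C * length al.
  by rewrite -expr2 CC !expr2; apply: H => //; rewrite CC.
rewrite -CC ler_sqr ?nnegrE //.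
  have [->|Cn] := eqVneq C 0; first exact: length_ge0.
  by rewrite -(ler_pM2l (_ : 0 < C)) // lt_neqAle eq_sym Cn.
exact: length_ge0.
Qed.

(** The coefficients are those of the periods of the first curve in [intersection_periods]. Each of
    the three norms to be bounded is that of a pair of numbers divided by n, and each pair is tested
    against itself by a combination chosen for its piece. *)
Lemma periods_comass (be : closed_curve R n) :
  let b := period be in
  comass n (fun i : 'I_4 => match val i with
    | 0%N => b 1 | 1%N => b 2 - b 0 | 2%N => b 3 - b 1 | _ => - b 2 end)
    (length be / N).
Proof.
move=> b.
have Np : 0 < N by rewrite ltr0n.
have N0 : N != 0 by rewrite gt_eqF.
pose form (c0 c1 c2 c3 : R) (i : 'I_4) : R := match val i with
  | 0%N => c0 | 1%N => c1 | 2%N => c2 | _ => c3 end.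
have formE c0 c1 c2 c3 : \sum_i form c0 c1 c2 c3 i * b i =
    c0 * b 0 + c1 * b 1 + c2 * b 2 + c3 * b 3.
  rewrite !big_ord_recl big_ord0 addr0 /form /= !addrA.
  by congr (_ * b _ + _ * b _ + _ * b _ + _ * b _); exact/val_inj.
have sq2 (x y : R) : x ^+ 2 + y ^+ 2 <= length be ^+ 2 ->
    (x / N) ^+ 2 + (y / N) ^+ 2 <= (length be / N) ^+ 2.
  by move=> xy; rewrite !exprMn -mulrDl ler_wpM2r // sqr_ge0.
have Nb (x : R) : x = (N * x) / N by rewrite mulrAC divff // mul1r.
have sq_div (y : R) : (y / N) ^+ 2 <= y ^+ 2.
  have Ni : N^-1 <= 1 by rewrite invf_le1 // ler1n.
  have Ni0 : 0 <= N^-1 by rewrite invr_ge0 ltW.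
  by rewrite exprMn ler_piMr ?sqr_ge0 // expr_le1.
have h1 : (N * b 1) ^+ 2 + (N * b 2) ^+ 2 <= length be ^+ 2.
  apply: sqr_le_of_period => C C0 hC.
  (* This combination is constant on the corner, with gradient [(0, N * b 1)] on the upper arm and
     [(N * b 2, 0)] on the right one, so the two weights do not compete although their contributions
     to the winding add up. *)
  have cC : comass n (form 0 (N * (N * b 1)) (N * (N * b 2)) 0) C.
    rewrite /comass /form /= -![N * (_ * _) / N]mulrA -!Nb.
    by split; have := sqr_ge0 (N * b 1); have := sqr_ge0 (N * b 2);
      have := sqr_ge0 C; lra.
  have := period_le_length be C0 cC; rewrite formE; lra.
have h2 : (N * b 1) ^+ 2 + (b 2 - b 0) ^+ 2 <= length be ^+ 2.
  move yE : (b 2 - b 0) => y.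
  apply: sqr_le_of_period => C C0 hC.
  (* The coefficients [- y] and [y] on [b 0] and [b 2] produce the square of [y]. On the right arm
     the gradient is [y / N] only, at most [y] in absolute value since n is positive. *)
  have cC : comass n (form (- y) (N * (N * b 1)) y 0) C.
    rewrite /comass /form /= -![N * (_ * _) / N]mulrA -!Nb sqrrN.
    have := sq_div y; have := sqr_ge0 (N * b 1).
    by split; lra.
  have := period_le_length be C0 cC; rewrite formE -yE; lra.
have h3 : (b 3 - b 1) ^+ 2 + (N * b 2) ^+ 2 <= length be ^+ 2.
  move yE : (b 3 - b 1) => y.
  apply: sqr_le_of_period => C C0 hC.
  have cC : comass n (form 0 (- y) (N * (N * b 2)) y) C.
    rewrite /comass /form /= -![N * (_ * _) / N]mulrA -!Nb mulNr sqrrN.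
    have := sq_div y; have := sqr_ge0 (N * b 2).
    by split; lra.
  have := period_le_length be C0 cC; rewrite formE -yE; lra.
split => /=.
- rewrite sqrrN [b 1]Nb [b 2]Nb; exact: sq2.
- rewrite [b 1]Nb; exact: sq2.
- rewrite sqrrN [b 2]Nb; exact: sq2.
Qed.

Lemma Int_le (al be : closed_curve R n) :
  Int al be <= length al * length be / N.
Proof.
have lb : 0 <= length be / N by rewrite divr_ge0 ?ler0n ?length_ge0.
(* If the defining set were empty, the value would be 0, which the nonnegative right side still
   bounds. *)
rewrite /Int /intersection; case: xgetP => [? _ /intersection_periods -> | _].
  have := period_le_length al lb (periods_comass be).
  rewrite !big_ord_recl big_ord0 addr0 /=.
  have -> : lift ord0 (ord0 : 'I_3) = 1 by exact/val_inj.
  have -> : lift ord0 (lift ord0 (ord0 : 'I_2)) = 2 by exact/val_inj.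
  have -> : lift ord0 (lift ord0 (lift ord0 (ord0 : 'I_1))) = 3 by exact/val_inj.
  have -> : (ord0 : 'I_4) = 0 by exact/val_inj.
  rewrite -!/(period al _) -!/(period be _).
  move: (length al) (length be) => x y.
  rewrite [x * y]mulrC [y * x / N]mulrAC; move: (y / N * x) => L.
  move: (period al 0) (period al 1) (period al 2) (period al 3) => a0 a1 a2 a3.
  move: (period be 0) (period be 1) (period be 2) (period be 3) => b0 b1 b2 b3.
  by lra.
by rewrite !mulr_ge0 ?length_ge0 // invr_ge0 ler0n.
Qed.

End Intersection.

(** * The extremal curves *)

Section AffineFunctions.
Variable R : realType.
Implicit Types a b : R.

Definition line a b (t : R) : R := a + t * b.

Lemma is_derive_line a b (t : R) : is_derive t 1 (line a b) b.
Proof.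
have -> : line a b = cst a + (id * cst b) by apply/funext.
have h := is_deriveM (is_derive_id t 1) (is_derive_cst b t 1).
have c := is_derive_cst a t (1 : R).
by have := is_deriveD c h; rewrite scaler0 !add0r /= [_%:A]mulr1.
Qed.

Lemma derive1_line a b : (line a b)^`()%classic = line b 0.
Proof.
apply/funext => t; rewrite derive1E /line mulr0 addr0.
have h := is_derive_line a b t; exact: derive_val.
Qed.

Lemma smooth_line a b : smooth (line a b).
Proof.
move=> k t; elim: k a b => [|k IH] a b.
  by have h := is_derive_line a b t; exact: ex_derive.
by rewrite derive1Sn derive1_line.
Qed.

Lemma piecewise_smooth_line a b : piecewise_smooth (line a b).
Proof.
exists [:: 1]; first exact: itv_partition1.
by move=> i _; exists (line a b) => //; exact: smooth_line.
Qed.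

End AffineFunctions.

Section Segment.
Variables (R : realType) (n : nat) (x y u w : R).
Local Notation Lpoly := (Lpoly R n).
Local Notation Lproj := (@Lproj R n).
Hypothesis inL : forall t, 0 <= t <= 1 -> Lpoly (line x u t, line y w t).

Definition segment_point (t : R) : Lpoly := mkL (inL (clamp_itv t)).

Hypothesis segment_closed : Lproj (segment_point 0) = Lproj (segment_point 1).

Lemma segment_point_continuous : continuous (Lproj \o segment_point).
Proof.
have cl a b : continuous (line a b \o clamp (R := R)).
  move=> t; apply: cvgD; first exact: cvg_cst.
  by apply: cvgM; [exact: clamp_continuous | exact: cvg_cst].
have c : continuous segment_point.
  by apply: continuous_comp_initial => t; exact: (cvg_pair (cl x u t) (cl y w t)).
move=> t; exact: (@continuous_comp _ _ _ _ _ t (c t) (@Lproj_continuous R n _)).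
Qed.

Definition segment : closed_curve R n.
Proof.
exists (Lproj \o segment_point) (line x u) (line y w).
- by apply: continuous_subspaceT; exact: segment_point_continuous.
- exact: segment_closed.
- move=> t t01; exists (segment_point t), 0, 0.
  by split; rewrite //= clamp_id // addr0.
- exact: piecewise_smooth_line.
- exact: piecewise_smooth_line.
Defined.

Lemma length_segment : length segment = Num.sqrt (u ^+ 2 + w ^+ 2).
Proof.
rewrite /length /= !derive1_line.
have -> : (fun t : R => Num.sqrt (line u 0 t ^+ 2 + line w 0 t ^+ 2)) =
    cst (Num.sqrt (u ^+ 2 + w ^+ 2)).
  by apply/funext => t; rewrite /line !mulr0 !addr0.
by rewrite Rintegral_cst //= lebesgue_measure_itv /= lte_fin ltr01 oppr0 adde0 mulr1.
Qed.

Lemma segment_chain (s : singular_simplex R (Lsurface R n) 1) :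
  (forall v, exists2 q : Lpoly, s v = Lproj q &
    val q = (line x u ((val v : 'rV[R]_2) 0 1), line y w ((val v : 'rV[R]_2) 0 1))) ->
  curve_chain segment = << s >>.
Proof.
move=> sE; congr << _ >>; apply: singular_simplex_eq => v.
have [q -> qE] := sE v; congr (Lproj _); apply: val_inj.
by rewrite qE /= clamp_id //; exact: simplex1_itv.
Qed.

End Segment.

Section LowerBound.
Variables (R : realType) (n : nat).
Local Notation Lpoly := (Lpoly R n).
Local Notation Lproj := (@Lproj R n).
Local Notation N := (n%:R : R).
Local Notation m := (fundamental_cycle R n).

Let N0 : 0 <= N. Proof. exact: ler0n. Qed.
Let N1 : n.+1%:R = N + 1 :> R. Proof. by rewrite -natr1. Qed.

Lemma short_in t : 0 <= t <= 1 -> Lpoly (line 0 1 t, line 0 0 t).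
Proof.
move=> /andP[t0 t1]; have Np := N0; left; rewrite /box /line /= !in_itv /= N1.
by split; apply/andP; split; lra.
Qed.

Lemma long_in t : 0 <= t <= 1 -> Lpoly (line 0 0 t, line 1 N t).
Proof.
move=> /andP[t0 t1]; left; rewrite /box /line /= !in_itv /= N1.
have tN0 : 0 <= t * N by rewrite mulr_ge0.
have tN1 : t * N <= N by rewrite ler_piMl.
by split; apply/andP; split; lra.
Qed.

(** The listed points are the ends of the two extremal edges. They are joined by gluings that pass
    through (n+1, 0), (n+1, 1) and (1, 1), all of them the conical point, so both edges are closed
    curves. *)
Lemma vertices_glued : exists v, forall p : Lpoly,
  val p \in [:: (0, 0); (1, 0); (0, 1); (0, n.+1%:R)] -> Lproj p = v.
Proof.
have gl (p q : R * R) : glued n p q -> forall p' q' : Lpoly,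
    val p' = p -> val q' = q -> Lproj p' = Lproj q'.
  by move=> pq p' q' pp qq; apply: Lproj_glued; rewrite pp qq.
have le1N : 1 <= n.+1%:R :> R by rewrite ler1n.
have le0N : 0 <= n.+1%:R :> R by rewrite ler0n.
have g1 : glued n (0, 0) (0, n.+1%:R : R).
  by exists 0; constructor 1; rewrite lexx ler01.
have g2 : glued n (1, 0) (1, 1 : R).
  by exists 1; constructor 2; rewrite lexx.
have g3 : glued n (0, 1) (1, 1 : R).
  by exists 1; constructor 4; rewrite lexx.
have g4 : glued n (0, 1) (n.+1%:R, 1 : R).
  by exists 1; constructor 3; rewrite lexx ler01.
have g5 : glued n (n.+1%:R, 0) (n.+1%:R, 1 : R).
  by exists n.+1%:R; constructor 2; rewrite lexx le1N.
have g6 : glued n (0, 0) (n.+1%:R, 0 : R).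
  by exists 0; constructor 3; rewrite lexx ler01.
pose v00 := mkL (glued_poly g1).1; pose v11 := mkL (glued_poly g2).2.
pose v01 := mkL (glued_poly g3).1; pose vN1 := mkL (glued_poly g4).2.
pose vN0 := mkL (glued_poly g5).1.
exists (Lproj v01) => p; rewrite !inE.
have e00 : Lproj v00 = Lproj v01.
  rewrite (gl _ _ g6 v00 vN0) // (gl _ _ g5 vN0 vN1) //.
  by rewrite (gl _ _ g4 v01 vN1).
case/or4P => /eqP pE.
- by rewrite -e00; congr (Lproj _); apply: val_inj.
- by rewrite (gl _ _ g2 p v11) // (gl _ _ g3 v01 v11).
- by congr (Lproj _); apply: val_inj.
- by rewrite -e00 (gl _ _ g1 v00 p).
Qed.

Lemma short_closed : Lproj (segment_point short_in 0) = Lproj (segment_point short_in 1).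
Proof.
have [v H] := vertices_glued.
have -> : Lproj (segment_point short_in 0) = v.
  apply: H; rewrite /= !clamp_id ?lexx ?ler01 // /line !inE.
  by apply/or4P; constructor 1; apply/eqP; congr (_, _); lra.
symmetry; apply: H; rewrite /= !clamp_id ?lexx ?ler01 // /line !inE.
by apply/or4P; constructor 2; apply/eqP; congr (_, _); lra.
Qed.

Lemma long_closed : Lproj (segment_point long_in 0) = Lproj (segment_point long_in 1).
Proof.
have [v H] := vertices_glued.
have -> : Lproj (segment_point long_in 0) = v.
  apply: H; rewrite /= !clamp_id ?lexx ?ler01 // /line !inE.
  by apply/or4P; constructor 3; apply/eqP; congr (_, _); lra.
symmetry; apply: H; rewrite /= !clamp_id ?lexx ?ler01 // /line !inE N1.
by apply/or4P; constructor 4; apply/eqP; congr (_, _); lra.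
Qed.

Definition short_curve := segment short_closed.
Definition long_curve := segment long_closed.

Lemma length_short : length short_curve = 1.
Proof. by rewrite length_segment expr1n expr0n addr0 sqrtr1. Qed.

Lemma length_long : length long_curve = N.
Proof. by rewrite length_segment expr0n add0r sqrtr_sqr ger0_norm. Qed.

Lemma short_chain : curve_chain short_curve = << corner_bottom R n >>.
Proof.
apply: segment_chain => v; have [q e qE] := bottomE ler01 ler01 (@sub_corner R n) v.
by exists q => //; rewrite qE /line; congr (_, _); lra.
Qed.

Lemma long_chain : curve_chain long_curve = << up_left R n >>.
Proof.
apply: segment_chain => v; have [q e qE] := leftE ler01 (@le1n R n) (@sub_up R n) v.
by exists q => //; rewrite qE /line; congr (_, _); rewrite ?N1; lra.
Qed.

Hypothesis n0 : (0 < n)%N.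

Lemma cocycle_lin (a b : R) (phi psi : cochain R (Lsurface R n) 1) :
  cocycle phi -> cocycle psi -> cocycle (fun s => a * phi s + b * psi s).
Proof.
by move=> /cocycleP h1 /cocycleP h2; apply/cocycleP => s; rewrite h1 h2; ring.
Qed.

(** The periods allow only the value 1; it remains to show that the defining set is not empty, by
    giving explicit Poincare duals of both edges. *)
Lemma Int_short_long : Int short_curve long_curve = 1.
Proof.
pose eta i := @angle_cochain R n i.
have ce i : cocycle (eta i) := angle_cochain_cocycle i.
(* Both cocycles are found by solving [poincare_dual_values] for the periods (1, 0, 0, 0) of the
   short edge and (0, 1, 0, 0) of the long one. *)
pose phi := (fun s => (- 1) * eta 1 s + 0 * eta 0 s).
pose psi := (fun s => 1 * eta 0 s + (- 1) * eta 2 s).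
have cphi : cocycle phi by exact: cocycle_lin.
have cpsi : cocycle psi by exact: cocycle_lin.
rewrite /Int /intersection; set S := (X in xget _ X).
have SE x : S x -> x = 1.
  move=> /(intersection_periods n0) ->.
  rewrite short_chain long_chain !pairingU.
  have E i := angle_edges R n0 i.
  have [-> _ _ _] := E 0; have [-> _ _ _] := E 1.
  have [-> _ _ _] := E 2; have [-> _ _ _] := E 3.
  have [_ -> _ _] := E 0; have [_ -> _ _] := E 1.
  have [_ -> _ _] := E 2; have [_ -> _ _] := E 3.
  by rewrite /=; lra.
apply: SE; apply: xgetPex; exists (pairing (cup phi psi) m), phi, psi.
have [a1 a2 a3 a4] := angle_edges R n0 0.
have [b1 b2 b3 b4] := angle_edges R n0 1.
have [c1 c2 c3 c4] := angle_edges R n0 2.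
split => //.
- exists 0; rewrite cap_fundamental // short_chain /phi /eta.
  rewrite a1 a2 a3 a4 b1 b2 b3 b4 /= !mulr0 !mulr1 !addr0 !scale0r.
  by rewrite !subr0 !add0r !addr0 scaleN1r opprK raddf0 subrr.
(* The cap product exceeds the long edge by [corner_right] minus [corner_left], the two ends of the
   right arm, and that arm bounds their difference. *)
- exists (- rect_chain (@le1n R n) ler01 (@sub_right R n)).
  rewrite cap_fundamental // long_chain /psi /eta.
  rewrite a1 a2 a3 a4 c1 c2 c3 c4 /= !mulr0 !mulr1 !addr0 !add0r !scale0r.
  rewrite raddfN /= boundary_rect.
  rewrite right_top_glued right_right_glued right_left_glued.
  rewrite !scale1r scaleN1r !subr0 addrAC addrK.
  by rewrite addrAC [X in - (X - _)]addrAC subrr add0r opprB.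
Qed.

End LowerBound.

(** * The area, the exact value of KVol, and the limit *)

Lemma Vol_Lsurface (R : realType) (n : nat) : Vol R n = (n.*2.+1%:R)%:E.
Proof.
have N0 : 0 <= n%:R :> R by exact: ler0n.
have N1 : n.+1%:R = n%:R + 1 :> R by rewrite -natr1.
(* The two boxes defining the polygon overlap in the corner square, which is removed from the second
   one to get a disjoint union. *)
have E : Lpoly R n = (`[0, 1] `*` `[0, n.+1%:R]) `|` (`]1, n.+1%:R] `*` `[0, 1]).
  apply/seteqP; split=> -[x y]; rewrite /Lpoly /box /setU /setX /= !in_itv /=.
    case=> [h|[/andP[x0 xN] /andP[y0 y1]]]; first by left.
    have [x1|x1] := leP x 1; [left|right].
      by split; apply/andP; split; lra.
    by rewrite xN y0.
  case=> [h|[/andP[x1 xN] h]]; [by left | right].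
  by split => //; apply/andP; split; lra.
have rect (i j : interval R) :
    (lebesgue_measure \x lebesgue_measure)%E ([set` i] `*` [set` j]) =
    (lebesgue_measure [set` i] * lebesgue_measure [set` j])%E.
  exact: product_measure1E.
rewrite /Vol E [LHS]measureU; last first.
- apply/seteqP; split=> -[x y] //=; rewrite !in_itv /=.
  by case=> -[/andP[_ h1] _] [/andP[h2 _] _]; move: h1; rewrite leNgt h2.
- exact: measurableX.
- exact: measurableX.
rewrite [X in (X + _)%E](rect `[0, 1] `[0, n.+1%:R]) [X in (_ + X)%E](rect _ `[0, 1]).
rewrite !lebesgue_measure_itv /= !lte_fin ltr01 ltr0Sn.
case: ifPn => [_|].
  by rewrite -!EFinB -!EFinM -EFinD -addnn -addSn natrD N1; congr EFin; ring.
(* Here n is 0 and the half-open arm is empty. *)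
rewrite -leNgt N1 gerDr => n0.
have nE : n%:R = 0 :> R by lra.
move: nE => /eqP; rewrite pnatr_eq0 => /eqP ->.
by rewrite mul0e adde0 -!EFinB -EFinM; congr EFin; rewrite double0 add0r !subr0 mulr1.
Qed.

Lemma KVol_Lsurface (R : realType) (n : nat) : (0 < n)%N ->
  KVol R n = (2 + n%:R^-1)%:E.
Proof.
move=> n0; have N0 : 0 < n%:R :> R by rewrite ltr0n.
rewrite /KVol Vol_Lsurface.
rewrite (_ : ereal_sup _ = (n%:R^-1)%:E).
  rewrite -EFinM -addnn -addnS natrD -natr1; congr EFin; field.
  by rewrite gt_eqF.
apply/le_anti/andP; split.
  apply: ge_ereal_sup => _ [al [be [la lb ->]]].
  move: la lb (Int_le n0 al be).
  move: (Int al be) (length al) (length be) => i x y x0 y0 h.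
  by rewrite lee_fin ler_pdivrMr ?mulr_gt0 // mulrC.
apply: ereal_sup_ubound; exists (short_curve R n), (long_curve R n).
by rewrite Int_short_long // length_short length_long !mul1r.
Qed.

Theorem proposition2p5 (R : realType) :
  KVol R n @[n --> \oo] --> (2%:R%:E : \bar R).
Proof.
(* The exact value is available for positive n only, hence the shift of the sequence. *)
rewrite -cvg_shiftS.
rewrite (_ : [sequence KVol R n.+1]_n = fun n => (2 + n.+1%:R^-1)%:E); last first.
  by apply/funext => n; exact: KVol_Lsurface.
apply: cvg_EFin; first exact: nearW.
have c : (fun=> 2 : R) @ \oo --> (2 : R) by exact: cvg_cst.
have h := cvgD c (@cvg_harmonic R); rewrite addr0 in h; exact: h.
Qed.
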